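(* Let $p>5$ be a prime. If $p\equiv 2\pmod 3$, then $$\sum_{k=0}^{p-1}\frac{\binom{2k}{k}\binom{3k}{k}\binom{6k}{3k}}{(-12288000)^k}\equiv 0\pmod{p^2}.$$ If $p\equiv 1\pmod 3$ and so $4p=L^2+27M^2$ with $L,M\in\mathbb{Z}$, then $$\sum_{k=0}^{p-1}\frac{\binom{2k}{k}\binom{3k}{k}\binom{6k}{3k}}{(-12288000)^k}\equiv \left(\frac{10}{p}\right)L^2\pmod p.$$
   Context: $\left(\frac{a}{p}\right)$ denotes the Legendre symbol. Congruences modulo $p$ and $p^2$ are in the ring of rational numbers whose denominator is coprime to $p$. *)

(* Defs.v *)
From mathcomp Require Export all_boot all_order all_algebra.
Set Implicit Arguments.
Unset Strict Implicit.
Unset Printing Implicit Defensive.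

Import GRing.Theory Num.Theory.
Local Open Scope ring_scope.

Definition legendre (a : int) (p : nat) : int :=
  if (p %| a)%Z then 0
  else if [exists x : 'I_p, ((x : nat)%:Z ^+ 2 == a %[mod p])%Z] then 1
  else -1.

Definition p_integral (p : nat) (x : rat) : bool := coprime p `|denq x|%N.

(* Congruence modulo the ideal generated by m in the ring of p-integral
   rationals; both sides are required to lie in that ring. *)
Definition congr_rat (p m : nat) (x y : rat) : Prop :=
  [/\ p_integral p x, p_integral p y
    & exists2 c : rat, p_integral p c & x - y = m%:R * c].

(* 12288000 = 3 * 160 ^ 3; kept factored because the literal would be expanded
   to a unary natural number. *)
Definition binom_sum (p : nat) : rat :=
  \sum_(0 <= k < p)
    ('C(2 * k, k) * 'C(3 * k, k) * 'C(6 * k, 3 * k))%N%:R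
      / (- (3 * 160 ^+ 3)) ^+ k.

(* Main.v *)
Require Import Defs.
From mathcomp Require Import all_solvable all_field.
From mathcomp Require Import ring lra zify.
Set Implicit Arguments.
Unset Strict Implicit.
Unset Printing Implicit Defensive.
Import Order.TTheory GRing.Theory Num.Theory.
Local Open Scope ring_scope.

(** Write a_k = C(3k,k) C(6k,3k) and c_k = C(2k,k) a_k. These are, up to
    powers of 432 and 1728, the coefficients of the hypergeometric series
    2F1(1/6,5/6;1) and 3F2(1/6,1/2,5/6;1,1), and the sum of the theorem is the
    value at y = -1/12288000 of the 3F2 truncated at p. The number -12288000
    is the j-invariant with complex multiplication by the order of
    discriminant -27, which is what makes the value computable.

    Clausen's formula says that the square of the series of the a_k x^k is
    the series of the c_k (x(1-432x))^k. Truncation at p destroys the identity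
    only in degrees at least p, where every coefficient of either side is
    divisible by p^2: the truncated identity holds modulo p^2
    ([clausen_congr]). It is used at the point x0 of Q(sqrt 10) with
    x0(1-432x0) = y, so it remains to find f = sum of the a_k x0^k modulo p.

    Let n = (p-1)/2. Modulo p, the number a_k is, up to the factor (-64)^k, the
    multinomial coefficient which occurs in the coefficient of z^(p-1) in
    (z^3 + e z^2 + s)^n ([coef2F1_pchar], [coef_cubic_exp]). Hence f is, up to
    a power of e, the Hasse invariant of Y^2 = z^3 + e z^2 + s, and for x0 this
    curve is a translate of the rational curve Y^2 = z^3 + 18z^2 - 12z + 2
    ([hasse_model], [clausen_value]).

    That curve has a rational 3-isogeny onto Y^2 = X^3 + 1458. An isogeny
    which pulls the invariant differential back to the invariant differential
    preserves the Hasse invariant, and the Hasse invariant of X^3 + 1458 is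
    read off the binomial expansion ([coef_curveP_exp]). If p = 2 mod 3 it is
    zero: then p divides f, and p^2 divides f^2. If p = 3m+1 its square is
    C(2m,m)^2 ([hasse_coef_sqr]), and the square of the power of e
    contributes the Legendre symbol of 10.

    Finally the cubic Jacobi sum J = a + b w of p = 3m+1 has norm p, has b
    divisible by 3, and satisfies 2a-b = -C(2m,m) modulo p up to sign, so
    L = 2a-b and M = b/3 represent 4p ([cubic_four_p]); and L^2 does not depend
    on the representation ([four_p_unique]). *)

(** * The square of a truncated 2F1 as a truncated 3F2 *)

(** Reduces an equation to a ring identity, given the multiplier that derives
    it from a known equation. *)
Lemma linear_comb_eq1 (R : comNzRingType) (x y x1 y1 A : R) :
  x1 = y1 -> x - y = A * (x1 - y1) -> x = y.
Proof. by move=> ->; rewrite subrr mulr0 => /subr0_eq. Qed.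

Lemma linear_comb_eq (R : comNzRingType) (x y x1 y1 x2 y2 x3 y3 A1 A2 A3 : R) :
  x1 = y1 -> x2 = y2 -> x3 = y3 ->
  x - y = A1 * (x1 - y1) + A2 * (x2 - y2) + A3 * (x3 - y3) -> x = y.
Proof. by move=> -> -> ->; rewrite !subrr !mulr0 !addr0 => /subr0_eq. Qed.

(** Locked, as is [coef3F2], so that simplification never exposes the binomial
    coefficients. *)
Definition coef2F1 (k : nat) : nat := locked ('C(3 * k, k) * 'C(6 * k, 3 * k))%N.
Definition coef3F2 (k : nat) : nat := locked ('C(2 * k, k) * coef2F1 k)%N.

Lemma coef2F1_fact k : (coef2F1 k * ((3 * k)`! * (2 * k)`! * k`!) = (6 * k)`!)%N.
Proof.
have e1 := @bin_fact (3 * k) k ltac:(lia).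
have e2 := @bin_fact (6 * k) (3 * k) ltac:(lia).
rewrite (_ : (3 * k - k = 2 * k)%N) in e1; last lia.
rewrite (_ : (6 * k - 3 * k = 3 * k)%N) in e2; last lia.
by rewrite /coef2F1; unlock; rewrite -e2 -{2}e1; lia.
Qed.

Lemma coef3F2_fact k : (coef3F2 k * ((3 * k)`! * k`! ^ 3) = (6 * k)`!)%N.
Proof.
have e1 := @bin_fact (2 * k) k ltac:(lia).
rewrite (_ : (2 * k - k = k)%N) in e1; last lia.
by rewrite -coef2F1_fact /coef3F2; unlock; rewrite -e1; lia.
Qed.

(** The hypergeometric recurrence (k+1)^2 a_(k+1) = 12 (6k+1)(6k+5) a_k, which
    is the differential equation of the 2F1 read on coefficients. *)
Lemma coef2F1S k :
  (k.+1 ^ 2 * coef2F1 k.+1 = 12 * (6 * k + 1) * (6 * k + 5) * coef2F1 k)%N.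
Proof.
have e := coef2F1_fact k; have e' := coef2F1_fact k.+1.
have pos : (0 < 72 * (3 * k + 1) * (3 * k + 2) * (2 * k + 1) *
  ((3 * k)`! * (2 * k)`! * k`!))%N.
  by rewrite !muln_gt0 !fact_gt0 !addn_gt0 /= !orbT.
apply/eqP; rewrite -(eqn_pmul2l pos); apply/eqP.
rewrite (_ : 6 * k.+1 = (6 * k).+4.+2)%N in e'; last lia.
rewrite (_ : 3 * k.+1 = (3 * k).+3)%N in e'; last lia.
rewrite (_ : 2 * k.+1 = (2 * k).+2)%N in e'; last lia.
rewrite !factS -e in e'.
move: (coef2F1 k) (coef2F1 k.+1) ((3 * k)`!) ((2 * k)`!) (k`!) e' {e pos} => a b x y z e'.
have {}e' : (12 * (b * ((3 * k).+3 * ((3 * k).+2 * ((3 * k).+1 * x)) *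
        ((2 * k).+2 * ((2 * k).+1 * y)) * (k.+1 * z))) =
 12 * ((6 * k).+4.+2 *
     ((6 * k).+4.+1 *
      ((6 * k).+4 * ((6 * k).+3 * ((6 * k).+2 * ((6 * k).+1 * (a * (x * y * z)))))))))%N.
  by rewrite e'.
suff : (k.+1 ^ 1 * (72 * (3 * k + 1) * (3 * k + 2) * (2 * k + 1) * (x * y * z) * (k.+1 ^ 2 * b)) =
  k.+1 ^ 1 * (72 * (3 * k + 1) * (3 * k + 2) * (2 * k + 1) * (x * y * z) *
  (12 * (6 * k + 1) * (6 * k + 5) * a)))%N.
  by move/eqP; rewrite eqn_pmul2l // => /eqP.
lia.
Qed.

Lemma coef3F2S k :
  (k.+1 ^ 3 * coef3F2 k.+1 =
   24 * (2 * k + 1) * (6 * k + 1) * (6 * k + 5) * coef3F2 k)%N.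
Proof.
have e : (k.+1 * 'C(2 * k.+1, k.+1) = 2 * (2 * k + 1) * 'C(2 * k, k))%N.
  have e1 := mul_bin_diag (2 * k).+2 k.
  have e2 := mul_bin_down (2 * k).+1 k.
  have -> : (2 * k.+1 = (2 * k).+2)%N by lia.
  rewrite -e1 /=.
  have e3 : ((2 * k).+1 - k = k.+1)%N by lia.
  rewrite e3 /= in e2; lia.
have e' := coef2F1S k; rewrite /coef3F2; unlock.
transitivity ((k.+1 * 'C(2 * k.+1, k.+1)) * (k.+1 ^ 2 * coef2F1 k.+1))%N; first by lia.
rewrite e e'; lia.
Qed.

Section Euler.
Variable R : comNzRingType.
Implicit Types p q : {poly R}.

(** The derivation x d/dx; it turns recurrences on coefficients into
    differential equations without shifts of the index. Locked, because 'X * p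
    unifies with too many products. *)
Definition euler p : {poly R} := locked ('X * p^`()).

Lemma coef_euler p i : (euler p)`_i = i%:R * p`_i.
Proof.
rewrite /euler; unlock; rewrite coefXM; case: i => [|i] /=; first by rewrite mul0r.
by rewrite coef_deriv mulr_natl.
Qed.
Lemma eulerD p q : euler (p + q) = euler p + euler q.
Proof. by rewrite /euler; unlock; rewrite derivD mulrDr. Qed.
Lemma eulerB p q : euler (p - q) = euler p - euler q.
Proof. by rewrite /euler; unlock; rewrite derivB mulrBr. Qed.
Lemma eulerN p : euler (- p) = - euler p.
Proof. by rewrite /euler; unlock; rewrite derivN mulrN. Qed.
Lemma eulerM p q : euler (p * q) = euler p * q + p * euler q.
Proof. by rewrite /euler; unlock; rewrite derivM; ring. Qed.
Lemma euler0 : euler (0 : {poly R}) = 0.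
Proof. by rewrite /euler; unlock; rewrite derivC mulr0. Qed.
Lemma eulerMn p n : euler (p *+ n) = euler p *+ n.
Proof. by rewrite /euler; unlock; rewrite derivMn mulrnAr. Qed.
Lemma euler1 : euler 1 = 0.
Proof. by rewrite /euler; unlock; rewrite derivC mulr0. Qed.
Lemma euler_nat n : euler n%:R = 0.
Proof. by rewrite eulerMn euler1 mul0rn. Qed.
Lemma eulerX : euler 'X = 'X.
Proof. by rewrite /euler; unlock; rewrite derivX mulr1. Qed.
Lemma eulerXn n : euler ('X^n) = n%:R * 'X^n.
Proof.
rewrite /euler; unlock; rewrite derivXn mulrnAr mulr_natl.
case: n => [|n]; first by rewrite !mulr0n.
by rewrite -exprS.
Qed.
End Euler.

(** A linear equation whose indicial polynomial at 0 is m^3 determines the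
    coefficient of degree m > 0 from the lower ones, up to the precision N to
    which the equation holds. *)
Lemma euler_ode_unique (N : nat) (U V A0 A1 A2 A3 : {poly int}) : U`_0 = 0 ->
  euler (euler (euler U))
    + 'X * (A3 * euler (euler (euler U)) + A2 * euler (euler U)
            + A1 * euler U + A0 * U) = 'X^N * V ->
  forall m, (m < N)%N -> U`_m = 0.
Proof.
move=> U0 ode; elim/ltn_ind => -[//|m] IH mN.
have vanish (A B : {poly int}) :
    (forall j, (j <= m)%N -> B`_j = 0) -> (A * B)`_m = 0.
  move=> B0; rewrite coefM big1 // => i _.
  by rewrite B0 ?mulr0 // leq_subr.
have Uj j : (j <= m)%N -> U`_j = 0.
  by move=> jm; apply: IH => //; lia.
have := congr1 (fun p : {poly int} => p`_m.+1) ode.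
rewrite /= coefXnM mN coefD !coef_euler coefXM /= !coefD !vanish; first last.
- by move=> j jm; rewrite !coef_euler Uj // !mulr0.
- by move=> j jm; rewrite !coef_euler Uj // !mulr0.
- by move=> j jm; rewrite !coef_euler Uj // !mulr0.
- by move=> j jm; rewrite Uj.
rewrite !addr0 => /eqP.
by rewrite !mulf_eq0 pnatr_eq0 /= => /eqP.
Qed.

Definition trunc2F1 N : {poly int} := \sum_(k < N) (coef2F1 k)%:R * 'X^k.
Definition clausen_arg : {poly int} := 'X * (1 - 432 * 'X).
Definition trunc3F2 N : {poly int} := \sum_(k < N) (coef3F2 k)%:R * clausen_arg ^+ k.

(** In terms of Z the singular point 1/432 of the equations is 36 Z = 1. *)
Local Notation Z := (12 * 'X : {poly int}).

(** All terms of the differential equation telescope, except for the first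
    one that is cut off. *)
Lemma trunc2F1_ode N :
  (1 - 36 * Z) * euler (euler (trunc2F1 N)) - 36 * Z * euler (trunc2F1 N) - 5 * Z * trunc2F1 N =
  - ((N ^ 2 * coef2F1 N)%N%:R * 'X^N).
Proof.
elim: N => [|N IH].
  by rewrite /trunc2F1 big_ord0 !euler0 !mulr0 mulr0n mul0r !subrr oppr0.
have -> : trunc2F1 N.+1 = trunc2F1 N + (coef2F1 N)%:R * 'X^N by rewrite /trunc2F1 big_ord_recr.
rewrite !(eulerD, eulerM, euler_nat, euler0, eulerXn) coef2F1S.
move: (trunc2F1 N) IH => F IH.
rewrite exprS.
move/eqP: IH; rewrite -subr_eq0 => /eqP IH; apply: subr0_eq; rewrite -[RHS]IH.
rewrite !(natrM, natrD, natrX).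
ring.
Qed.

(** Logarithmic derivative of y = x(1-432x), with denominators cleared. *)
Lemma euler_clausen_pow k : (1 - 36 * Z) * euler (clausen_arg ^+ k) =
  k%:R * (1 - 72 * Z) * clausen_arg ^+ k.
Proof.
elim: k => [|k IH]; first by rewrite expr0 euler1 mulr0 mulr0n !mul0r.
rewrite exprS eulerM mulrDr [X in _ + X]mulrCA IH /clausen_arg.
rewrite !(eulerB, eulerM, euler_nat, euler0, euler1, eulerX) -[k.+1]addn1 natrD.
ring.
Qed.

(** The symmetric square of the operator of [trunc2F1_ode]: it annihilates the
    products of two solutions. *)
Definition clausen_op (u : {poly int}) : {poly int} :=
  (1 - 36 * Z) ^+ 2 * euler (euler (euler u))
  - 108 * Z * (1 - 36 * Z) * euler (euler u)
  + (2 * (36 * Z) ^+ 2 - 36 * Z - 20 * Z * (1 - 36 * Z)) * euler u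
  + (720 * Z ^+ 2 - 10 * Z) * u.

(** In terms of y = x(1-432x) the operator [clausen_op] becomes, up to the factor
    (1-72Z)/(1-36Z), the hypergeometric operator of the 3F2. *)
Lemma clausen_op_pow k : (1 - 36 * Z) * clausen_op (clausen_arg ^+ k) =
  (1 - 72 * Z) * (k%:R ^+ 3 * clausen_arg ^+ k -
    24 * (2 * k%:R + 1) * (6 * k%:R + 1) * (6 * k%:R + 5) * clausen_arg ^+ k.+1).
Proof.
have -> : clausen_arg ^+ k.+1 = 'X * (1 - 432 * 'X) * clausen_arg ^+ k.
  by rewrite exprS.
rewrite /clausen_op.
have e1 := euler_clausen_pow k.
have e2 : (1 - 36 * Z) * euler (euler (clausen_arg ^+ k)) - 36 * Z * euler (clausen_arg ^+ k) =
  k%:R * (1 - 72 * Z) * euler (clausen_arg ^+ k) - 72 * k%:R * Z * clausen_arg ^+ k.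
  have := congr1 (@euler _) e1.
  rewrite !(eulerM, eulerB, eulerX, euler_nat, euler1) => h.
  by apply: (linear_comb_eq1 (A := 1) h); ring.
have e3 : (1 - 36 * Z) * euler (euler (euler (clausen_arg ^+ k)))
   - 72 * Z * euler (euler (clausen_arg ^+ k)) - 36 * Z * euler (clausen_arg ^+ k) =
  k%:R * (1 - 72 * Z) * euler (euler (clausen_arg ^+ k))
   - 144 * k%:R * Z * euler (clausen_arg ^+ k) - 72 * k%:R * Z * clausen_arg ^+ k.
  have := congr1 (@euler _) e2.
  rewrite !(eulerM, eulerB, eulerX, euler_nat, euler1) => h.
  by apply: (linear_comb_eq1 (A := 1) h); ring.
pose w := 36 * Z.
pose c : {poly int} := k%:R.
(* Eliminate the third, second and first derivatives in this order. *)
apply: (linear_comb_eq (A1 := (1 - w) * (w - 4 * w * c)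
    + (c * (1 - 2 * w) - w) * (w + c * (1 - 2 * w)) + 2 * w ^+ 2 - w - 20 * Z * (1 - w))
   (A2 := (1 - w) * (c * (1 - 2 * w) - w))
   (A3 := (1 - w) ^+ 2) e1 e2 e3).
rewrite /w /c.
ring.
Qed.

(** The symmetric square on an approximate solution F, of error E. *)
Lemma clausen_op_sqr (F E : {poly int}) :
  (1 - 36 * Z) * euler (euler F) - 36 * Z * euler F - 5 * Z * F = E ->
  clausen_op (F ^+ 2) = 2 * (1 - 36 * Z) * F * euler E
    + (6 * (1 - 36 * Z) * euler F - 72 * Z * F) * E.
Proof.
move=> e.
have e' := congr1 (@euler _) e.
rewrite !(eulerM, eulerB, eulerX, euler_nat, euler1) in e'.
rewrite /clausen_op expr2 !(eulerM, eulerD).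
rewrite -e' -e.
ring.
Qed.

Lemma clausen_opD u v : clausen_op (u + v) = clausen_op u + clausen_op v.
Proof. by rewrite /clausen_op !eulerD; ring. Qed.

Lemma clausen_opB u v : clausen_op (u - v) = clausen_op u - clausen_op v.
Proof. by rewrite /clausen_op !eulerB; ring. Qed.

Lemma clausen_opZ n u : clausen_op (n%:R * u) = n%:R * clausen_op u.
Proof.
by rewrite /clausen_op !(eulerM, eulerD, euler_nat, euler0); ring.
Qed.

Lemma trunc3F2_ode N : (1 - 36 * Z) * clausen_op (trunc3F2 N) =
  - ((1 - 72 * Z) * (N ^ 3 * coef3F2 N)%N%:R * clausen_arg ^+ N).
Proof.
elim: N => [|N IH].
  by rewrite /trunc3F2 big_ord0 /clausen_op !euler0 mul0n mulr0n; ring.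
rewrite /trunc3F2 big_ord_recr /= -/(trunc3F2 N) clausen_opD clausen_opZ mulrDr IH.
rewrite [X in _ + X]mulrCA clausen_op_pow coef3F2S !(natrM, natrD, natrX).
ring.
Qed.

(** Clausen's formula. Both sides are solutions of the equation of [clausen_op]
    up to precision N, with the same constant term. *)
Lemma clausen_identity_trunc N m : (m < N)%N -> (trunc3F2 N)`_m = (trunc2F1 N ^+ 2)`_m.
Proof.
case: N => [//|N] mN; apply/eqP; rewrite -subr_eq0 -coefB; apply/eqP.
pose w := 36 * Z.
(* (1 - w) times [clausen_op], written in the form of [euler_ode_unique]. *)
pose A3 : {poly int} := 432 * (- 3 + 3 * w - w ^+ 2).
pose A2 : {poly int} := - 1296 * (1 - w) ^+ 2.
pose A1 : {poly int} := (1 - w) * (432 * (2 * w - 1) - 240 * (1 - w)).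
pose A0 : {poly int} := (1 - w) * (8640 * Z - 120).
pose s : {poly int} := (N.+1 ^ 2 * coef2F1 N.+1)%N%:R.
pose t : {poly int} := (N.+1 ^ 3 * coef3F2 N.+1)%N%:R.
pose V : {poly int} := - (1 - 72 * Z) * t * (1 - 432 * 'X) ^+ N.+1
  + (1 - w) * s * (2 * (1 - w) * trunc2F1 N.+1 * N.+1%:R
     + (6 * (1 - w) * euler (trunc2F1 N.+1) - 72 * Z * trunc2F1 N.+1)).
have U0 : (trunc3F2 N.+1 - trunc2F1 N.+1 ^+ 2)`_0 = 0.
  rewrite -horner_coef0 /trunc3F2 /trunc2F1 hornerD hornerN horner_exp !horner_sum.
  rewrite !big_ord_recl !big1 => [|i _|i _]; rewrite ?addr0.
  - by rewrite !expr0 !mulr1 /coef3F2 /coef2F1; unlock; rewrite !hornerC subrr.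
  - by rewrite hornerM hornerXn /= exprS mul0r mulr0.
  - by rewrite hornerM horner_exp /clausen_arg hornerM hornerX mul0r exprS mul0r mulr0.
apply: (euler_ode_unique (A3 := A3) (A2 := A2) (A1 := A1) (A0 := A0) (V := V) U0 _ mN).
have sq := clausen_op_sqr (trunc2F1_ode N.+1).
rewrite eulerN eulerM euler_nat mul0r add0r eulerXn -/s in sq.
have cub := trunc3F2_ode N.+1.
rewrite /clausen_arg exprMn -/t in cub.
transitivity ((1 - w) * clausen_op (trunc3F2 N.+1 - trunc2F1 N.+1 ^+ 2)).
  by rewrite /clausen_op /A0 /A1 /A2 /A3 /w; ring.
rewrite clausen_opB mulrBr cub sq /V /w.
ring.
Qed.

(** * Divisibility by the square of the prime *)

(** Below p^2 Legendre's formula has only one term. *)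
Lemma logn_fact_lt_sqr p n : prime p -> (n < p ^ 2)%N -> logn p n`! = (n %/ p)%N.
Proof.
move=> p_pr np2; rewrite logn_fact //.
have p_gt1 := prime_gt1 p_pr.
case: n np2 => [|n] np2; first by rewrite big_geq // div0n.
rewrite big_ltn // expn1 big_nat_cond big1 ?addn0 // => i /andP[/andP[i1 _] _].
apply: divn_small; apply: leq_trans np2 _; rewrite leq_exp2l //.
Qed.

Lemma coef2F1_gt0 k : (0 < coef2F1 k)%N.
Proof. by have := fact_gt0 (6 * k); rewrite -coef2F1_fact muln_gt0 => /andP[]. Qed.

Lemma coef3F2_gt0 k : (0 < coef3F2 k)%N.
Proof. by have := fact_gt0 (6 * k); rewrite -coef3F2_fact muln_gt0 => /andP[]. Qed.

Section Valuation.
Variable p : nat.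
Hypotheses (p_pr : prime p) (p_gt5 : (5 < p)%N).

(** Hence p >= 7, so that 6k < p^2 for all k < p and [logn_fact_lt_sqr] applies. *)
Lemma p_neq6 : p != 6%N.
Proof. by apply/eqP => p6; move: p_pr; rewrite p6. Qed.

Lemma logn_coef2F1 k : (k < p)%N ->
  (logn p (coef2F1 k) + (3 * k %/ p) + (2 * k %/ p) = 6 * k %/ p)%N.
Proof.
move=> kp; have p6 := p_neq6.
have := congr1 (logn p) (coef2F1_fact k).
rewrite !lognM ?muln_gt0 ?fact_gt0 ?coef2F1_gt0 //.
rewrite !logn_fact_lt_sqr // ?(divn_small kp) ?addn0 ?addnA //; nia.
Qed.

Lemma logn_coef3F2 k : (k < p)%N ->
  (logn p (coef3F2 k) + (3 * k %/ p) = 6 * k %/ p)%N.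
Proof.
move=> kp; have p6 := p_neq6.
have := congr1 (logn p) (coef3F2_fact k).
rewrite lognM ?muln_gt0 ?expn_gt0 ?fact_gt0 ?coef3F2_gt0 //.
rewrite lognM ?expn_gt0 ?fact_gt0 //.
rewrite lognX !logn_fact_lt_sqr // ?(divn_small kp) ?muln0 ?addn0 //; nia.
Qed.

Lemma div_ge c n : (c * p <= n)%N -> (c <= n %/ p)%N.
Proof. by rewrite leq_divRL ?prime_gt0. Qed.

Lemma div_lt c n : (n < c * p)%N -> (n %/ p < c)%N.
Proof. by rewrite ltn_divLR ?prime_gt0. Qed.

Lemma logn_coef2F1_ge1 k : (k < p)%N -> (p <= 6 * k)%N -> (1 <= logn p (coef2F1 k))%N.
Proof.
move=> kp pk; have e := logn_coef2F1 kp.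
have [k3|k3] := ltnP (3 * k) (1 * p).
  have := @div_ge 1 (6 * k) ltac:(lia); have := div_lt k3.
  have := @div_lt 1 (2 * k) ltac:(lia); lia.
have [k2|k2] := ltnP (2 * k) (1 * p).
  have := @div_ge 2 (6 * k) ltac:(lia); have := div_lt k2.
  have := @div_lt 2 (3 * k) ltac:(lia); lia.
have w := @div_lt 2 (2 * k) ltac:(lia).
have [k3'|k3'] := ltnP (3 * k) (2 * p).
  by have := @div_ge 3 (6 * k) ltac:(lia); have := div_lt k3'; lia.
have := @div_ge 4 (6 * k) ltac:(lia); have := @div_lt 3 (3 * k) ltac:(lia); lia.
Qed.

Lemma logn_coef2F1_ge2 k : (k < p)%N -> (5 * p <= 6 * k)%N -> (2 <= logn p (coef2F1 k))%N.
Proof.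
move=> kp pk; have := logn_coef2F1 kp; have := div_ge pk.
have := @div_lt 3 (3 * k) ltac:(lia); have := @div_lt 2 (2 * k) ltac:(lia); lia.
Qed.

Lemma logn_coef3F2_ge2 k : (k < p)%N -> (p <= 2 * k)%N -> (2 <= logn p (coef3F2 k))%N.
Proof.
move=> kp pk; have e := logn_coef3F2 kp.
have [k3|k3] := ltnP (3 * k) (2 * p).
  by have := @div_ge 3 (6 * k) ltac:(lia); have := div_lt k3; lia.
have := @div_ge 4 (6 * k) ltac:(lia); have := @div_lt 3 (3 * k) ltac:(lia); lia.
Qed.

Lemma dvdn_coef2F1 k : (k < p)%N -> (p <= 6 * k)%N -> (p %| coef2F1 k)%N.
Proof.
by move=> kp pk; rewrite -{1}[p]expn1 pfactor_dvdn ?coef2F1_gt0 ?logn_coef2F1_ge1.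
Qed.

Lemma dvdn_coef3F2 k : (k < p)%N -> (p <= 2 * k)%N -> (p ^ 2 %| coef3F2 k)%N.
Proof. by move=> kp pk; rewrite pfactor_dvdn ?coef3F2_gt0 ?logn_coef3F2_ge2. Qed.

Lemma dvdn_coef2F1_mul i j : (i < p)%N -> (j < p)%N -> (p <= i + j)%N ->
  (p ^ 2 %| coef2F1 i * coef2F1 j)%N.
Proof.
move=> ip jp pij; rewrite pfactor_dvdn ?muln_gt0 ?coef2F1_gt0 // lognM ?coef2F1_gt0 //.
have [i6|i6] := ltnP (6 * i) p.
  by apply: (leq_trans (@logn_coef2F1_ge2 j jp ltac:(lia))); rewrite leq_addl.
have [j6|j6] := ltnP (6 * j) p.
  by apply: (leq_trans (@logn_coef2F1_ge2 i ip ltac:(lia))); rewrite leq_addr.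
exact: leq_add (logn_coef2F1_ge1 ip i6) (logn_coef2F1_ge1 jp j6).
Qed.

Lemma coef_trunc2F1 N i : (trunc2F1 N)`_i = if (i < N)%N then (coef2F1 i)%:R else 0.
Proof.
have -> : trunc2F1 N = \poly_(k < N) (coef2F1 k)%:R.
  by rewrite poly_def; apply: eq_bigr => k _; rewrite scaler_nat mulr_natl.
by rewrite coef_poly.
Qed.

Lemma coef_clausen_arg_exp k i : (2 * k < i)%N -> (clausen_arg ^+ k)`_i = 0.
Proof.
move=> ki; rewrite nth_default //; apply: leq_trans (ki).
have sz : (size clausen_arg <= 3)%N.
  have s2 : (size (1 - 432 * 'X : {poly int})%R <= 2)%N.
    rewrite (leq_trans (size_polyD _ _)) // geq_max size_poly1 /= size_polyN.
    by rewrite mulr_natl -scaler_nat (leq_trans (size_scale_leq _ _)) ?size_polyX.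
  rewrite /clausen_arg; apply: leq_trans (size_polyMleq _ _) _.
  by rewrite size_polyX.
apply: leq_trans (size_poly_exp_leq _ _) _.
rewrite ltnS; nia.
Qed.

(** Below degree p this is Clausen's formula. A coefficient of degree m >= p is
    a sum of terms a_i a_j with i + j = m, or of multiples of some c_k with
    2k >= m; all of these are divisible by p^2. *)
Lemma clausen_congr : exists Q : {poly int}, trunc3F2 p - trunc2F1 p ^+ 2 = (p ^ 2)%N%:R * Q.
Proof.
suff dvd i : ((p ^ 2)%N%:Z %| (trunc3F2 p - trunc2F1 p ^+ 2)`_i)%Z.
  set P := trunc3F2 p - trunc2F1 p ^+ 2 in dvd *.
  exists (\poly_(i < size P) (P`_i %/ (p ^ 2)%N%:Z)%Z).
  apply/polyP => i; rewrite mulr_natl coefMn coef_poly -mulr_natl.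
  case: ltnP => [_|Pi]; last by rewrite mulr0 nth_default.
  by rewrite mulrC natz divzK.
rewrite coefB; case: (ltnP i p) => [ip|pi].
  by rewrite clausen_identity_trunc // subrr dvdz0.
apply: rpredB.
  rewrite /trunc3F2 coef_sum; apply: rpred_sum => k _.
  rewrite mulr_natl coefMn; case: (leqP p (2 * k)) => [pk|kp].
    by rewrite -mulr_natr natz dvdz_mull // dvdzE /= dvdn_coef3F2.
  by rewrite coef_clausen_arg_exp ?mul0rn ?rpred0 //; lia.
rewrite expr2 coefM; apply: rpred_sum => k _.
rewrite !coef_trunc2F1; case: ltnP => kp; last by rewrite mul0r rpred0.
case: ltnP => ikp; last by rewrite mulr0 rpred0.
rewrite -natrM natz dvdzE /= dvdn_coef2F1_mul //; have := ltn_ord k; lia.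
Qed.
End Valuation.

(** * Invariance of the Hasse invariant under a 3-isogeny *)

(** The curve y^2 = x^3 - 120x + 506 in the coordinate z = x - 6, which puts the
    kernel of the 3-isogeny above z = 0. *)
Definition curve_poly (R : comNzRingType) : {poly R} :=
  'X^3 + 18 * 'X^2 - 12 * 'X + 2.

Lemma size_natX (R : comNzRingType) m i k : (i < k)%N -> (size (m%:R * 'X^i : {poly R})%R <= k)%N.
Proof.
move=> ik; rewrite mulr_natl -scaler_nat (leq_trans (size_scale_leq _ _)) //.
by rewrite size_polyXn.
Qed.

Lemma size_addl_leq (R : comNzRingType) (A B : {poly R}) k :
  (size A <= k)%N -> (size B <= k)%N -> (size (A + B)%R <= k)%N.
Proof.
by move=> sA sB; rewrite (leq_trans (size_polyD _ _)) // geq_max sA sB.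
Qed.

Lemma size_curve_poly (R : comNzRingType) : (size (curve_poly R) <= 4)%N.
Proof.
have -> : curve_poly R = 1%:R * 'X^3 + 18 * 'X^2 - 12 * 'X^1 + 2 * 'X^0.
  by rewrite /curve_poly; ring.
by do !apply: size_addl_leq; rewrite ?size_polyN size_natX.
Qed.

Section Isogeny.
Variables (F : fieldType) (p n : nat).
Local Notation curveP := (curve_poly F).
Hypotheses (charF : p \in [pchar F]) (pE : p = n.*2.+1) (n_gt0 : (0 < n)%N).

Lemma deriv_natr m : (m%:R : {poly F})^`() = 0.
Proof. by rewrite derivMn derivC mul0rn. Qed.

(** X = [isogN] / z^2 and Y = y [isogR] / z^3 is Velu's isogeny whose kernel consists
    of the point at infinity and the two points above z = 0. *)
Definition isogN : {poly F} := 'X^3 + 6 * 'X^2 - 24 * 'X + 8.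
Definition isogR : {poly F} := 'X^3 + (24 * 'X - 16).

(** The isogeny takes its values on Y^2 = X^3 + 1458. *)
Lemma isogeny_curve : 1458 * 'X^6 + isogN ^+ 3 = curveP * isogR ^+ 2.
Proof. rewrite /curve_poly /isogN /isogR; ring. Qed.

(** Divided by z^3, this is dX/dz = [isogR] / z^3: the form dX/Y pulls back
    to dz/y. *)
Lemma isogeny_deriv : isogN^`() * 'X - 2 * isogN = isogR.
Proof.
rewrite /isogN /isogR !(deriv_natr, derivN, derivM, derivXn, derivX, derivD) /=.
ring.
Qed.

Lemma monic_cubic (A B : {poly F}) : (size B <= 3)%N -> A = 'X^3 + B ->
  A \is monic /\ size A = 4%N.
Proof.
move=> sB ->; have sA : size ('X^3 + B) = 4%N.
  by rewrite size_polyDl ?size_polyXn.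
by rewrite monicE lead_coefDl ?size_polyXn ?lead_coefXn.
Qed.

Lemma isogN_monic : isogN \is monic /\ size isogN = 4%N.
Proof.
apply: (@monic_cubic _ (6 * 'X^2 - 24 * 'X^1 + 8 * 'X^0)); last first.
  by rewrite /isogN; ring.
by do !apply: size_addl_leq; rewrite ?size_polyN size_natX.
Qed.

Lemma isogR_monic : isogR \is monic /\ size isogR = 4%N.
Proof.
apply: (@monic_cubic _ (24 * 'X^1 - 16 * 'X^0)); last by rewrite /isogR; ring.
by apply: size_addl_leq; rewrite ?size_polyN size_natX.
Qed.

Lemma natr_p0 m : (p %| m)%N -> m%:R = 0 :> F.
Proof. by rewrite (dvdn_pcharf charF) => /eqP. Qed.

Lemma coef_deriv_pchar (q : {poly F}) i : (p %| i.+1)%N -> (q^`())`_i = 0.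
Proof. by move=> pi; rewrite coef_deriv -mulr_natr natr_p0 ?mulr0. Qed.

(** As X = [isogN] / z^2 and dX = [isogR] / z^3 dz, the left-hand side is X^a dX
    times (a+1) z^(b+2a+3), and the hypothesis says that z^(b+2a+3) has derivative zero. *)
Lemma isog_term_exact a b : (b.+1%:R : {poly F}) = - (2 * a.+1%:R) ->
  isogN ^+ a * 'X^b * isogR *+ a.+1 = (isogN ^+ a.+1 * 'X^(b.+1))^`().
Proof.
move=> e; rewrite derivM derivXn deriv_exp -isogeny_deriv.
rewrite [a.+1.-1]/= [b.+1.-1]/=.
rewrite -(mulr_natr (_ * _ * _) a.+1) -(mulr_natr (_ * _) a.+1) -(mulr_natr 'X^b) e.
rewrite (exprS isogN a) (exprS 'X b).
move: (a.+1%:R) (isogN^`()) isogN ('X^b) => c N' N x.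
ring.
Qed.

(** With p = 2n+1 the power of z in [isog_term_exact] is z^(3p). A derivative has no term
    of degree -1 mod p, so the only index left is the one with 3i = p-1, and there the
    coefficient is the leading one. *)
Lemma coef_isog_term i : (i <= n)%N ->
  (isogN ^+ (3 * i) * 'X^(6 * (n - i)) * isogR)`_(4 * p).-1 = (3 * i == n.*2)%:R.
Proof.
move=> in_; case: eqP => [e3|ne3].
  have [mN sN] := isogN_monic; have [mR sR] := isogR_monic.
  have mNi := monic_exp (3 * i) mN.
  set T := isogN ^+ (3 * i) * 'X^(6 * (n - i)) * isogR.
  have mT : T \is monic by rewrite !monicMr ?monicXn.
  have sNi : size (isogN ^+ (3 * i)) = (9 * i).+1.
    rewrite -(@prednK (size (isogN ^+ (3 * i)))) ?size_poly_gt0 ?monic_neq0 //.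
    by rewrite size_exp sN mulnA.
  have sT : size T = (4 * p)%N.
    rewrite /T size_monicM ?monic_neq0 ?monicMr ?monicXn //.
    rewrite size_monicM ?monic_neq0 ?monicXn // size_polyXn sR sNi pE; lia.
  by rewrite -sT -lead_coefE (eqP mT).
have nz : (3 * i).+1%:R != 0 :> F.
  rewrite -(dvdn_pcharf charF); apply/negP => /dvdnP[[|[|q]]]; lia.
apply: (mulfI nz); rewrite mulr0 mulr_natl -coefMn.
rewrite isog_term_exact; last first.
  apply/eqP; rewrite -addr_eq0 -natrM -natrD -polyC_natr natr_p0 ?polyC0 //.
  by apply/dvdnP; exists 3; lia.
by rewrite coef_deriv_pchar //; apply/dvdnP; exists 4; lia.
Qed.

(** The right-hand side is the coefficient of X^(p-1) in (X^3 + 1458)^n, the Hasse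
    invariant of the image of the isogeny. Both sides are the coefficient of z^(4p-1) in
    [curve_poly]^n [isogR]^p. On the one hand [isogR]^p = z^(3p) + W^p with W linear, and
    W^p only contributes in lower degrees. On the other hand this product is the
    pull-back of (X^3 + 1458)^n dX times z^(3p). *)
Lemma coef_curveP_exp : (curveP ^+ n)`_n.*2 =
  \sum_(i < n.+1 | (3 * i == n.*2)%N) 'C(n, i)%:R * 1458 ^+ (n - i).
Proof.
pose W : {poly F} := 24 * 'X - 16.
have expR : isogR ^+ p = 'X^(3 * p) + W ^+ p.
  rewrite /isogR exprDn_pchar -?exprM //.
  by rewrite pnatE ?pchar_poly ?(pcharf_prime charF).
have : (curveP ^+ n * isogR ^+ p)`_(4 * p).-1 = (curveP ^+ n)`_n.*2.
  rewrite expR mulrDr coefD coefMXn ifF; last by lia.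
  rewrite [X in _ + X]nth_default ?addr0; first by congr (_`__); lia.
  apply: leq_trans (size_polyMleq _ _) _.
  have sW : (size W <= 2)%N.
    have -> : W = 24 * 'X^1 - 16 * 'X^0 by rewrite /W; ring.
    by apply: size_addl_leq; rewrite ?size_polyN size_natX.
  have sWp : (size (W ^+ p) <= p.+1)%N.
    apply: leq_trans (size_poly_exp_leq _ _) _.
    by rewrite ltnS -{2}[p]mul1n leq_mul2r; case: (size W) sW => [|[|[]]] //=; rewrite orbT.
  have sPn : (size (curveP ^+ n) <= (3 * n).+1)%N.
    apply: leq_trans (size_poly_exp_leq _ _) _.
    by rewrite ltnS leq_mul2r -subn1 leq_subLR size_curve_poly orbT.
  rewrite -subn1 leq_subLR; apply: (leq_trans (leq_add sPn sWp)); lia.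
move=> <-.
have -> : curveP ^+ n * isogR ^+ p = (curveP * isogR ^+ 2) ^+ n * isogR.
  by rewrite exprMn -exprM -mulrA -exprSr mul2n pE.
rewrite -isogeny_curve exprDn mulr_suml coef_sum [RHS]big_mkcond /=.
apply: eq_bigr => i _; have in_ : (i <= n)%N by rewrite -ltnS.
have -> : (1458 * 'X^6) ^+ (n - i) * (isogN ^+ 3) ^+ i *+ 'C(n, i) * isogR =
   ('C(n, i)%:R * 1458 ^+ (n - i))%:P *
     (isogN ^+ (3 * i) * 'X^(6 * (n - i)) * isogR) :> {poly F}.
  rewrite polyCM polyC_exp !polyC_natr exprMn -!exprM -mulr_natl; ring.
by rewrite coefCM coef_isog_term //; case: eqP; rewrite ?mulr1 ?mulr0.
Qed.
End Isogeny.

(** * Coefficients of powers of cubic polynomials *)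

Section HalfBinomial.
Variables (F : fieldType) (p n : nat).
Hypotheses (charF : p \in [pchar F]) (pE : p = n.*2.+1).

(** In characteristic p = 2n+1 one has n = -1/2, and C(-1/2,j) = C(2j,j)/(-4)^j. *)
Lemma bin_half j : (j < p)%N ->
  'C(2 * j, j)%:R = (- 4) ^+ j * 'C(n, j)%:R :> F.
Proof.
elim: j => [|j IH] jp; first by rewrite muln0 !bin0 expr0 mulr1.
have nz : j.+1%:R != 0 :> F.
  by rewrite -(dvdn_pcharf charF); apply/negP => /dvdn_leq -/(_ isT); lia.
apply: (mulfI nz).
have e1 := mul_bin_diag (2 * j).+2 j.
have e2 := mul_bin_down (2 * j).+1 j.
have e3 : ((2 * j).+1 - j = j.+1)%N by lia.
rewrite e3 /= in e2; rewrite /= in e1.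
have -> : (2 * j.+1 = (2 * j).+2)%N by lia.
have -> : j.+1%:R * 'C((2 * j).+2, j.+1)%:R = 2 * (2 * j%:R + 1) * 'C(2 * j, j)%:R :> F.
  transitivity ((2 * (2 * j + 1) * 'C(2 * j, j))%N%:R : F).
    by rewrite -natrM -e1; congr (_%:R); lia.
  by rewrite !natrM natrD natrM.
have e4 := mul_bin_left n j.
rewrite [RHS]mulrCA -[X in _ = _ * X]natrM e4 natrM IH 1?ltnW // exprS.
have [jn|nj] := leqP j n; last by rewrite bin_small // !mulr0.
have p0 : n%:R + n%:R + 1 = 0 :> F by rewrite -natrD natr1 addnn -pE pcharf0.
have -> : (n - j)%:R = - (n%:R + 1 + j%:R) :> F.
  by rewrite natrB //; apply: subr0_eq; rewrite -[RHS]p0; ring.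
suff -> : 2 * (2 * j%:R + 1) = - 4 * - (n%:R + 1 + j%:R) - 2 * (n%:R + n%:R + 1) :> F.
  by rewrite p0; ring.
ring.
Qed.

(** C(n,k) C(n-k,2k) = C(n,3k) C(3k,k), and C(n,3k) reduces to C(6k,3k) by
    [bin_half]. When 3k > n both sides vanish, the left one because p
    divides a_k. *)
Lemma coef2F1_pchar k : (k < p)%N -> (p %| coef2F1 k)%N || (6 * k < p)%N ->
  (coef2F1 k)%:R = (- 64) ^+ k * ('C(n, k) * 'C(n - k, 2 * k))%N%:R :> F.
Proof.
move=> kp pk; have [kn|nk] := leqP (3 * k) n.
  have -> : ('C(n, k) * 'C(n - k, 2 * k) = 'C(n, 3 * k) * 'C(3 * k, k))%N.
    have pos : (0 < k`! * (2 * k)`! * (n - 3 * k)`!)%N by rewrite !muln_gt0 !fact_gt0.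
    apply/eqP; rewrite -(eqn_pmul2r pos); apply/eqP.
    have e1 := @bin_fact n k ltac:(lia).
    have e2 := @bin_fact (n - k) (2 * k) ltac:(lia).
    have e3 := @bin_fact n (3 * k) ltac:(lia).
    have e4 := @bin_fact (3 * k) k ltac:(lia).
    rewrite (_ : (n - k - 2 * k = n - 3 * k)%N) in e2; last by lia.
    rewrite (_ : (3 * k - k = 2 * k)%N) in e4; last by lia.
    transitivity n`!; first by rewrite -e1 -e2; lia.
    by rewrite -e3 -e4; lia.
  rewrite /coef2F1; unlock; rewrite mulnC !natrM.
  have -> : (6 * k = 2 * (3 * k))%N by lia.
  rewrite bin_half; last by lia.
  have e64 : (- 4) ^+ 3 = - 64 :> F by ring.
  by rewrite exprM e64; ring.
rewrite (_ : ('C(n, k) * 'C(n - k, 2 * k) = 0)%N); last first.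
  have [kn|?] := leqP k n; last by rewrite bin_small.
  by rewrite (@bin_small (n - k)) ?muln0 //; lia.
rewrite mulr0; case/orP: pk => [|]; last by lia.
by rewrite (dvdn_pcharf charF) => /eqP.
Qed.
End HalfBinomial.

(** The expansion around the nodal cubic s = 0; this is why it matches the
    2F1 at its singular point 0. *)
Lemma coef_cubic_exp (R : comNzRingType) (e s : R) n :
  (('X^3 + e *: 'X^2 + s%:P) ^+ n)`_n.*2 =
  \sum_(k < n.+1) ('C(n, k) * 'C(n - k, 2 * k))%N%:R * e ^+ (n - 3 * k) * s ^+ k.
Proof.
have -> : 'X^3 + e *: 'X^2 + s%:P = 'X^2 * ('X + e%:P) + s%:P.
  by rewrite -mul_polyC; ring.
rewrite exprDn coef_sum; apply: eq_bigr => k _.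
have kn : (k <= n)%N by rewrite -ltnS.
rewrite coefMn -polyC_exp coefMC exprMn -exprM ['X^_ * _]mulrC coefMXn ifF; last by lia.
have -> : (n.*2 - 2 * (n - k) = 2 * k)%N by lia.
rewrite addrC exprDn coef_sum.
have [kn2|nk2] := leqP (2 * k) (n - k).
  rewrite (bigD1 (Ordinal (kn2 : (2 * k < (n - k).+1)%N))) //= big1 => [|i ne].
    rewrite addr0 coefMn -polyC_exp coefCM coefXn eqxx mulr1 -subnDA.
    rewrite (_ : (k + 2 * k = 3 * k)%N); last by lia.
    by rewrite natrM -(mulr_natr (_ * _)) -(mulr_natr (e ^+ _)); ring.
  rewrite coefMn -polyC_exp coefCM coefXn; case: eqP => [e2|_].
    by case/eqP: ne; apply: val_inj.
  by rewrite mulr0 mul0rn.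
rewrite (bin_small nk2) muln0 !mul0r big1 ?mul0r ?mul0rn // => i _.
rewrite coefMn -polyC_exp coefCM coefXn; case: eqP => [e2|_].
  by have := ltn_ord i; lia.
by rewrite mulr0 mul0rn.
Qed.

Lemma coef_translate (R : comNzRingType) (r : R) (P : {poly R}) m :
  (P \Po ('X + r%:P))`_m = \sum_(j < size P) P`_j * (r ^+ (j - m) *+ 'C(j, m)).
Proof.
rewrite comp_polyE coef_sum; apply: eq_bigr => j _.
rewrite coefZ addrC exprDn coef_sum; congr (_ * _).
have [mj|jm] := leqP m j.
  rewrite (bigD1 (Ordinal (mj : (m < j.+1)%N))) //= big1 => [|i ne].
    by rewrite addr0 coefMn -polyC_exp coefCM coefXn eqxx mulr1.
  rewrite coefMn -polyC_exp coefCM coefXn; case: eqP => [e2|_].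
    by case/eqP: ne; apply: val_inj.
  by rewrite mulr0 mul0rn.
rewrite (bin_small jm) mulr0n big1 // => i _.
rewrite coefMn -polyC_exp coefCM coefXn; case: eqP => [e2|_].
  by have := ltn_ord i; lia.
by rewrite mulr0 mul0rn.
Qed.

(** * Cubic Jacobi sums and the representation of 4p *)

Section PrimeField.
Variable p : nat.
Hypothesis p_pr : prime p.
Local Notation F := 'F_p.

Lemma Fp_fermat (x : F) : x != 0 -> x ^+ p.-1 = 1.
Proof.
move=> x0; apply: (mulfI x0); rewrite mulr1 -exprS prednK ?prime_gt0 //.
by have := expf_card x; rewrite card_Fp.
Qed.

Lemma Fp_prim_root : exists g : F, p.-1.-primitive_root g.
Proof.
have p1 : (0 < p.-1)%N by have := prime_gt1 p_pr; lia.
have : has p.-1.-primitive_root [seq x <- enum F | x != 0].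
  apply: has_prim_root => //.
  - by apply/allP => x; rewrite mem_filter => /andP[x0 _]; apply/unity_rootP/Fp_fermat.
  - by rewrite filter_uniq ?enum_uniq.
  rewrite size_filter.
  have := count_predC (fun x : F => x != 0) (enum F).
  rewrite -cardT card_Fp //.
  have -> : count (predC (fun x : F => x != 0)) (enum F) = 1%N.
    rewrite (eq_count (a2 := pred1 0)); last by move=> x /=; rewrite negbK.
    by rewrite count_uniq_mem ?enum_uniq // mem_enum.
  by rewrite addn1 => e; apply: (eq_leq (esym (congr1 predn e))).
by case/hasP => g _ ?; exists g.
Qed.

Lemma Fp_natp : p%:R = 0 :> F.
Proof. exact: (pcharf0 (pchar_Fp p_pr)). Qed.

Section Generator.
Variable g : F.
Hypothesis gP : p.-1.-primitive_root g.

Lemma gen_neq0 : g != 0.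
Proof.
apply/eqP => g0; have := prim_expr_order gP; have := prim_order_gt0 gP.
by rewrite g0 expr0n; case: p.-1 => // k _ /eqP; rewrite eq_sym oner_eq0.
Qed.

Lemma gen_pow (x : F) : x != 0 -> exists i : nat, x = g ^+ i.
Proof. by move=> /Fp_fermat /(prim_rootP gP) [i ->]; exists i. Qed.

Lemma sum_reindex_mul (V : nmodType) (f : F -> V) (c : F) : c != 0 ->
  \sum_x f x = \sum_x f (c * x).
Proof. by move=> c0; rewrite (reindex_inj (mulfI c0)). Qed.

(** Multiplication of x by g multiplies the sum by g^k, which differs from 1
    unless p-1 divides k. *)
Lemma power_sum k : (0 < k)%N ->
  \sum_(x : F) x ^+ k = if (p.-1 %| k)%N then -1 else 0.
Proof.
move=> k0; case: ifPn => [/dvdnP[q kE]|ndvd].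
  rewrite (bigD1 0) //= expr0n eqn0Ngt k0 add0r.
  rewrite (eq_bigr (fun=> 1)); last first.
    by move=> x x0; rewrite kE mulnC exprM Fp_fermat ?expr1n.
  rewrite sumr_const cardC1 card_Fp //; apply/eqP.
  by rewrite -subr_eq0 opprK -mulrSr prednK ?prime_gt0 // Fp_natp.
apply/eqP; have := sum_reindex_mul (fun x : F => x ^+ k) gen_neq0.
under [RHS]eq_bigr do rewrite exprMn.
rewrite -mulr_sumr => /eqP; rewrite -subr_eq0 -{1}[\sum_x _]mul1r -mulrBl mulf_eq0.
by rewrite subr_eq0 eq_sym -(prim_order_dvd gP) (negPf ndvd).
Qed.
End Generator.

Section CubicCharacter.
Variables (m : nat) (g : F).
Hypotheses (pE : p = (3 * m).+1) (gP : p.-1.-primitive_root g).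
Let zeta := g ^+ m.

Lemma m_gt0 : (0 < m)%N.
Proof. by have := prime_gt1 p_pr; lia. Qed.

Lemma predpE : p.-1 = (3 * m)%N.
Proof. by rewrite pE. Qed.

Lemma zeta3 : zeta ^+ 3 = 1.
Proof. by rewrite -exprM mulnC -(prim_expr_order gP) predpE. Qed.

Lemma zeta_neq1 : zeta != 1.
Proof.
rewrite -(prim_order_dvd gP) predpE; apply/negP => /dvdn_leq -/(_ m_gt0).
by have := m_gt0; lia.
Qed.

Lemma zeta_quad : zeta ^+ 2 + zeta + 1 = 0.
Proof.
have e : (zeta - 1) * (zeta ^+ 2 + zeta + 1) = 0.
  by transitivity (zeta ^+ 3 - 1); [ring | rewrite zeta3 subrr].
by move/eqP: e; rewrite mulf_eq0 subr_eq0 (negPf zeta_neq1) => /eqP.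
Qed.

Section Values.
Variables (R : idomainType) (w : R).
Hypotheses (w_quad : w ^+ 2 + w + 1 = 0).

(** The cubic character is x^m, with the cube root of unity zeta of F_p
    replaced by w. The target R varies: the algebraic numbers give the norm of the
    Jacobi sum, F_p itself gives its reduction. *)
Definition cubic_char (x : F) : R :=
  if x == 0 then 0 else if x ^+ m == 1 then 1
  else if x ^+ m == zeta then w else w ^+ 2.

Lemma cube_root_exp3 : w ^+ 3 = 1.
Proof.
apply: subr0_eq; transitivity ((w - 1) * (w ^+ 2 + w + 1)); first by ring.
by rewrite w_quad mulr0.
Qed.

Lemma pow_mod3 (S : comNzRingType) (y : S) i : y ^+ 3 = 1 -> y ^+ i = y ^+ (i %% 3).
Proof. by move=> y3; rewrite {1}(divn_eq i 3) exprD mulnC exprM y3 expr1n mul1r. Qed.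

Lemma cubic_charE x i : x != 0 -> x ^+ m = zeta ^+ i -> cubic_char x = w ^+ i.
Proof.
move=> x0; rewrite (pow_mod3 i zeta3) (pow_mod3 i cube_root_exp3) /cubic_char (negPf x0) => ->.
have z1 := zeta_neq1.
have z0 : zeta != 0 by rewrite expf_neq0 // (gen_neq0 gP).
have : (i %% 3 < 3)%N by rewrite ltn_mod.
case: (i %% 3)%N => [|[|[|//]]] _.
- by rewrite !expr0 eqxx.
- by rewrite !expr1 (negPf z1) eqxx.
rewrite ifF; last first.
  apply/eqP => z2; case/eqP: z1.
  by have := zeta3; rewrite exprS z2 mulr1.
rewrite ifF //; apply/eqP => z2; case/eqP: z1; apply: (mulfI z0).
by rewrite mulr1 -expr2.
Qed.

Lemma cubic_char_ex x : x != 0 -> exists2 i, x ^+ m = zeta ^+ i & cubic_char x = w ^+ i.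
Proof.
move=> x0; have [i xE] := gen_pow gP x0.
have e : x ^+ m = zeta ^+ i by rewrite xE -!exprM mulnC.
by exists i => //; apply: cubic_charE.
Qed.

Lemma cubic_char0 : cubic_char 0 = 0.
Proof. by rewrite /cubic_char eqxx. Qed.

Lemma cubic_char1 : cubic_char 1 = 1.
Proof. by rewrite (@cubic_charE 1 0) ?oner_eq0 ?expr1n. Qed.

Lemma cubic_charM x y : cubic_char (x * y) = cubic_char x * cubic_char y.
Proof.
have [->|x0] := eqVneq x 0; first by rewrite !(mul0r, cubic_char0).
have [->|y0] := eqVneq y 0; first by rewrite !(mulr0, cubic_char0).
have [i ei ->] := cubic_char_ex x0; have [j ej ->] := cubic_char_ex y0.
by rewrite -exprD; apply: cubic_charE; rewrite ?mulf_neq0 // exprMn ei ej exprD.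
Qed.

Lemma cubic_char_cube x : x != 0 -> cubic_char x ^+ 3 = 1.
Proof.
by move=> x0; have [i _ ->] := cubic_char_ex x0; rewrite exprAC cube_root_exp3 expr1n.
Qed.

Lemma cubic_char_sum : w != 1 -> \sum_x cubic_char x = 0.
Proof.
move=> w_neq1; have := sum_reindex_mul cubic_char (gen_neq0 gP).
under [RHS]eq_bigr do rewrite cubic_charM.
rewrite -mulr_sumr (@cubic_charE g 1) ?(gen_neq0 gP) // expr1 => e.
have /eqP : (1 - w) * \sum_x cubic_char x = 0 by rewrite mulrBl mul1r -e subrr.
by rewrite mulf_eq0 subr_eq0 eq_sym (negPf w_neq1) => /eqP.
Qed.

Definition jacobi : R := \sum_x cubic_char x * cubic_char (1 - x).
End Values.

Lemma quad_sqr (R : comNzRingType) (w : R) :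
  w ^+ 2 + w + 1 = 0 -> (w ^+ 2) ^+ 2 + w ^+ 2 + 1 = 0.
Proof.
move=> w_quad; transitivity ((w ^+ 2 - w + 1) * (w ^+ 2 + w + 1)); first by ring.
by rewrite w_quad mulr0.
Qed.

Lemma cubic_char_sqr (R : idomainType) (w : R) x : w ^+ 2 + w + 1 = 0 ->
  cubic_char (w ^+ 2) x = cubic_char w x ^+ 2.
Proof.
move=> w_quad; have [->|x0] := eqVneq x 0; first by rewrite !cubic_char0 expr0n.
have [i e ->] := cubic_char_ex w_quad x0.
by rewrite (cubic_charE (quad_sqr w_quad) x0 e) exprAC.
Qed.

Section Norm.
Variables (R : idomainType) (w : R).
Hypotheses (w_quad : w ^+ 2 + w + 1 = 0) (w_neq1 : w != 1).
Local Notation chi := (cubic_char w).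

Lemma w_sqr_neq1 : w ^+ 2 != 1.
Proof.
apply/eqP => w2; case/eqP: w_neq1.
by have := cube_root_exp3 w_quad; rewrite exprS w2 mulr1.
Qed.

Lemma sum_affine (c t : F) : c != 0 -> \sum_u chi (u * c + t) = 0.
Proof.
move=> c0; transitivity (\sum_x chi x); last exact: cubic_char_sum.
rewrite [RHS](reindex (fun u => u * c + t)) //.
exists (fun v => (v - t) / c) => u _ /=.
  by rewrite addrK mulfK.
by rewrite divfK // subrK.
Qed.

(** The substitution u = 1/(1-y) makes (1-yt)/(1-y) affine in u, and a
    nontrivial character sums to zero over an affine line; the removed
    points u = 0, 1 give the two corrections. *)
Lemma jacobi_inner (t : F) :
  \sum_(y | (y != 0) && (y != 1)) chi (1 - y * t) * chi (1 - y) ^+ 2 =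
  (if t == 1 then p%:R else 0) - chi t - 1.
Proof.
rewrite (reindex (fun u : F => 1 - u^-1)) /=; last first.
  by exists (fun y => (1 - y)^-1) => y _ /=; rewrite ?invrK subKr ?invrK.
rewrite (eq_big (fun u : F => (u != 0) && (u != 1)) (fun u => chi (u * (1 - t) + t))).
- transitivity (\sum_u chi (u * (1 - t) + t) - chi t - 1).
    rewrite [in RHS](bigD1 0) //= [X in _ = _ + X - _ - _](bigD1 1) ?oner_eq0 //=.
    rewrite mul0r add0r mul1r subrK cubic_char1 //.
    rewrite addrC addrA addrAC; ring.
  congr (_ - _ - _); case: eqP => [->|/eqP t1].
    rewrite (eq_bigr (fun=> 1)); last first.
      by move=> u _; rewrite subrr mulr0 add0r cubic_char1.
    by rewrite sumr_const card_Fp.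
  by rewrite sum_affine // subr_eq0 eq_sym.
- move=> u; rewrite subr_eq0 [1 == _]eq_sym invr_eq1 -[X in _ && (_ != X)]subr0.
  by rewrite (inj_eq (subrI _)) invr_eq0 andbC.
move=> u /andP[]; rewrite subr_eq0 [1 == _]eq_sym invr_eq1 => u1.
rewrite -[X in _ != X]subr0 (inj_eq (subrI _)) invr_eq0 => u0.
have -> : chi (1 - (1 - u^-1)) ^+ 2 = chi u.
  have -> : 1 - (1 - u^-1) = u^-1 by ring.
  apply: (mulfI (x := chi (u^-1))).
    apply/eqP => e; have := cubic_char_cube w_quad (invr_neq0 u0).
    by rewrite e expr0n => /eqP; rewrite eq_sym oner_eq0.
  by rewrite -exprS cubic_char_cube ?invr_neq0 // -cubic_charM // mulVf // cubic_char1.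
rewrite -cubic_charM //; congr (cubic_char _ _).
by field.
Qed.

(** The substitution x = yt separates chi(t) from the sums [jacobi_inner]. *)
Lemma jacobi_norm : jacobi w * jacobi (w ^+ 2) = p%:R.
Proof.
rewrite /jacobi mulr_sumr.
rewrite (bigID (fun y : F => (y != 0) && (y != 1))) /= [X in _ + X]big1 ?addr0; last first.
  move=> y; rewrite negb_and !negbK => /orP[] /eqP ->.
    by rewrite cubic_char0 mul0r mulr0.
  by rewrite subrr cubic_char0 !mulr0.
transitivity (\sum_(y | (y != 0) && (y != 1)) \sum_t
    chi t * (chi (1 - y * t) * chi (1 - y) ^+ 2)).
  apply: eq_bigr => y /andP[y0 y1].
  rewrite (sum_reindex_mul _ y0) mulr_suml; apply: eq_bigr => t _.
  rewrite cubic_charM // !cubic_char_sqr //.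
  transitivity (chi y ^+ 3 * (chi t * (chi (1 - y * t) * chi (1 - y) ^+ 2))).
    by ring.
  by rewrite cubic_char_cube // mul1r.
rewrite exchange_big /=.
transitivity (\sum_t ((if t == 1 then p%:R else 0) - chi t ^+ 2 - chi t)).
  apply: eq_bigr => t _; rewrite -mulr_sumr jacobi_inner.
  by case: eqP => [->|_]; rewrite ?cubic_char1 //; ring.
rewrite !sumrB cubic_char_sum // subr0.
rewrite -big_mkcond big_pred1_eq.
under eq_bigr do rewrite -cubic_char_sqr //.
by rewrite cubic_char_sum ?subr0 ?quad_sqr ?w_sqr_neq1.
Qed.
End Norm.

(** The coordinates are signed counts of the values of chi(x(1-x)), hence do
    not depend on R. *)
Lemma jacobi_coords : exists a b : int, forall (R : idomainType) (w : R),
  w ^+ 2 + w + 1 = 0 -> jacobi w = a%:~R + b%:~R * w.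
Proof.
pose A (z : F) : int := if z == 0 then 0 else if z ^+ m == 1 then 1
  else if z ^+ m == zeta then 0 else -1.
pose B (z : F) : int := if z == 0 then 0 else if z ^+ m == 1 then 0
  else if z ^+ m == zeta then 1 else -1.
exists (\sum_x A (x * (1 - x))), (\sum_x B (x * (1 - x))) => R w w_quad.
rewrite !rmorph_sum mulr_suml -big_split; apply: eq_bigr => x _ /=.
rewrite -cubic_charM // /cubic_char /A /B.
case: eqP => _; first by rewrite mul0r addr0.
case: eqP => _; first by rewrite mul0r addr0.
case: eqP => _; first by rewrite mul1r add0r.
by apply: subr0_eq; rewrite -[RHS]w_quad; ring.
Qed.

Section EisensteinIntegers.
Variable w : algC.
Hypothesis w_quad : w ^+ 2 + w + 1 = 0.

Definition eisenstein (z : algC) := exists c d : int, z = c%:~R + d%:~R * w.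

Lemma eisensteinD x y : eisenstein x -> eisenstein y -> eisenstein (x + y).
Proof.
move=> [a [b ->]] [c [d ->]]; exists (a + c), (b + d).
by rewrite !intrD; ring.
Qed.

Lemma eisensteinM x y : eisenstein x -> eisenstein y -> eisenstein (x * y).
Proof.
move=> [a [b ->]] [c [d ->]]; exists (a * c - b * d), (a * d + b * c - b * d).
rewrite !(intrD, mulrNz, intrM).
apply: subr0_eq; rewrite -(mulr0 (b%:~R * d%:~R)) -w_quad; ring.
Qed.

Lemma eisenstein_inj (u v : int) : u%:~R + v%:~R * w = 0 :> algC -> u = 0 /\ v = 0.
Proof.
(* This is four times the norm of u + v w. *)
move=> e; have : ((2 * u - v) ^+ 2 + 3 * v ^+ 2)%:~R = 0 :> algC.
  transitivity (4 * ((u%:~R + v%:~R * w) * (u%:~R + v%:~R * w ^+ 2)) : algC);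
    last by rewrite e mul0r mulr0.
  rewrite ?expr2 !(intrD, mulrNz, intrM).
  apply: (linear_comb_eq1 (A := - 4 * (u%:~R * v%:~R + v%:~R ^+ 2 * (w - 1))) w_quad).
  ring.
move/eqP; rewrite intr_eq0 => /eqP; nia.
Qed.

Lemma cubic_char_sub1 x : x != 0 ->
  exists2 z, eisenstein z & cubic_char w x - 1 = (w - 1) * z.
Proof.
move=> x0; rewrite /cubic_char (negPf x0).
case: eqP => _; first by exists 0; [exists 0, 0; ring | rewrite subrr mulr0].
case: eqP => _; first by exists 1; [exists 1, 0; ring | rewrite mulr1].
by exists (w + 1); [exists 1, 1; ring | ring].
Qed.

(** J + p is the sum of the (chi(x) - 1)(chi(1-x) - 1); a factor is divisible by
    w - 1 unless its argument is 0, in which case the other factor vanishes; and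
    (w - 1)^2 = -3w. *)
Lemma jacobi_mod3 (w_neq1 : w != 1) : exists2 z, eisenstein z & jacobi w + p%:R = 3 * z.
Proof.
have -> : jacobi w + p%:R =
    \sum_x (cubic_char w x - 1) * (cubic_char w (1 - x) - 1).
  transitivity (\sum_x (cubic_char w x * cubic_char w (1 - x) -
      cubic_char w x - cubic_char w (1 - x) + 1)); last by apply: eq_bigr => x _; ring.
  rewrite big_split /= !sumrB sumr_const card_Fp // -/(jacobi w).
  have -> : \sum_x cubic_char w (1 - x) = 0.
    transitivity (\sum_x cubic_char w x); last exact: cubic_char_sum.
    by rewrite [RHS](reindex_inj (inv_inj (subKr 1))).
  by rewrite cubic_char_sum // !subr0.
pose P z := exists2 y, eisenstein y & z = 3 * y.
apply: (big_ind P) => [|x y [u eu ->] [v ev ->]|x _].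
- by exists 0; [exists 0, 0; ring | ring].
- by exists (u + v); [apply: eisensteinD | ring].
have [->|x0] := eqVneq x 0.
  by rewrite subr0 cubic_char1 // subrr mulr0; exists 0; [exists 0, 0; ring | ring].
have [->|x1] := eqVneq x 1.
  by rewrite cubic_char1 // subrr mul0r; exists 0; [exists 0, 0; ring | ring].
have [u eu ->] := cubic_char_sub1 x0.
have [v ev ->] := @cubic_char_sub1 (1 - x) ltac:(by rewrite subr_eq0 eq_sym).
exists (- w * (u * v)).
  by apply: eisensteinM; [exists 0, (-1); ring | exact: eisensteinM].
apply: (linear_comb_eq1 (A := u * v) w_quad).
ring.
Qed.
End EisensteinIntegers.

Lemma jacobi_power_sum k : (0 < k)%N ->
  \sum_(x : F) (x * (1 - x)) ^+ k =
  - \sum_(i < k.+1 | (p.-1 %| k + i)%N) (-1) ^+ i * 'C(k, i)%:R.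
Proof.
move=> k0.
transitivity (\sum_(i < k.+1) (-1) ^+ i * 'C(k, i)%:R * \sum_(x : F) x ^+ (k + i)).
  under [RHS]eq_bigr do rewrite mulr_sumr.
  rewrite exchange_big; apply: eq_bigr => x _ /=.
  rewrite exprMn exprDn mulr_sumr; apply: eq_bigr => i _.
  by rewrite expr1n mul1r [(- x) ^+ _]exprNn exprD -mulr_natr; ring.
rewrite -sumrN [RHS]big_mkcond; apply: eq_bigr => i _ /=.
rewrite (power_sum gP) ?addn_gt0 ?k0 //.
by case: ifP => _; rewrite ?mulrN1 ?mulr0.
Qed.

(** With w = zeta the Jacobi sum a + b zeta is a sum of powers x^(m+i) of
    exponents below p-1, hence zero; with w = zeta^2 the exponent p-1 occurs once,
    in the middle. Adding both gives 2a-b modulo p. *)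
Lemma cubic_four_p : exists L M : int,
  4 * p%:Z = L ^+ 2 + 27 * M ^+ 2 /\ L%:~R ^+ 2 = 'C(2 * m, m)%:R ^+ 2 :> F.
Proof.
have [a [b ab]] := jacobi_coords.
have m0 := m_gt0.
have zq := zeta_quad; have zq2 := quad_sqr zq.
have [w w_quad w_neq1] : exists2 w : algC, w ^+ 2 + w + 1 = 0 & w != 1.
  have [w wP] := C_prim_root_exists (isT : (0 < 3)%N).
  have w_neq1 : w != 1 by rewrite -[w]expr1 -(prim_order_dvd wP).
  exists w => //; have : (w - 1) * (w ^+ 2 + w + 1) = 0.
    by transitivity (w ^+ 3 - 1); [ring | rewrite (prim_expr_order wP) subrr].
  by move/eqP; rewrite mulf_eq0 subr_eq0 (negPf w_neq1) => /eqP.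
have norm : a ^+ 2 - a * b + b ^+ 2 = p%:Z.
  have := jacobi_norm w_quad w_neq1; rewrite !ab ?quad_sqr // => e.
  apply/eqP; rewrite -(eqr_int algC) -[p%:~R]/(p%:R) -e; apply/eqP.
  rewrite ?expr2 !(intrD, mulrNz, intrM).
  apply: (linear_comb_eq1 (A := - (a%:~R * b%:~R + b%:~R ^+ 2 * (w - 1))) w_quad).
  ring.
have [d bE] : exists d, b = 3 * d.
  have [z [c [d ->]]] := jacobi_mod3 w_quad w_neq1.
  rewrite ab // => e; exists d.
  have [] := @eisenstein_inj w w_quad (a + p%:Z - 3 * c) (b - 3 * d); last by lia.
  rewrite !(intrD, mulrNz, intrM) -[p%:~R]/(p%:R).
  by apply: (linear_comb_eq1 (A := 1) e); ring.
exists (2 * a - b), d; split; first by rewrite -norm bE; ring.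
have charz x : cubic_char zeta x = x ^+ m.
  have [->|x0] := eqVneq x 0; first by rewrite cubic_char0 expr0n eqn0Ngt m0.
  by have [i e ->] := cubic_char_ex zq x0.
have J1 : a%:~R + b%:~R * zeta = 0 :> F.
  rewrite -ab // /jacobi.
  transitivity (\sum_(x : F) (x * (1 - x)) ^+ m).
    by apply: eq_bigr => x _; rewrite !charz exprMn.
  rewrite jacobi_power_sum // big1 ?oppr0 // => i /dvdn_leq.
  by have := ltn_ord i; rewrite predpE; lia.
have J2 : a%:~R + b%:~R * zeta ^+ 2 = - ((-1) ^+ m * 'C(2 * m, m)%:R) :> F.
  rewrite -ab // /jacobi.
  transitivity (\sum_(x : F) (x * (1 - x)) ^+ (2 * m)).
    apply: eq_bigr => x _; rewrite !cubic_char_sqr // !charz -!exprM.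
    by rewrite -exprMn mulnC.
  rewrite jacobi_power_sum ?muln_gt0 ?m0 //; congr (- _).
  have mlt : (m < (2 * m).+1)%N by lia.
  rewrite (bigD1 (Ordinal mlt)) /=; last by rewrite predpE (_ : 2 * m + m = 3 * m)%N //; lia.
  rewrite big1 ?addr0 // => i /andP[/dvdnP[q qE]] /eqP ne; case: ne; apply: val_inj => /=.
  move: (ltn_ord i) qE; rewrite predpE; case: q => [|[|q]]; lia.
have -> : (2 * a - b)%:~R = (a%:~R + b%:~R * zeta) + (a%:~R + b%:~R * zeta ^+ 2) :> F.
  rewrite intrB intrM.
  by apply: (linear_comb_eq1 (A := - b%:~R) zq); ring.
by rewrite J1 J2 add0r sqrrN exprMn sqrr_sign mul1r.
Qed.
End CubicCharacter.
End PrimeField.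

(** Since 4p (M'^2 - M^2) = (L M' - L' M)(L M' + L' M), after a change of
    sign of M' p divides L M' - L' M. The product of the two norms shows
    that 27 (L M' - L' M)^2 <= 16 p^2, so this multiple of p is zero. *)
Lemma four_p_unique (p : nat) (L M L' M' : int) : prime p ->
  4 * p%:Z = L ^+ 2 + 27 * M ^+ 2 -> 4 * p%:Z = L' ^+ 2 + 27 * M' ^+ 2 ->
  L ^+ 2 = L' ^+ 2.
Proof.
move=> p_pr e e'; have p0 : (0 < p%:Z) by rewrite ltz_nat prime_gt0.
have key (N : int) : 4 * p%:Z = L' ^+ 2 + 27 * N ^+ 2 ->
    (p%:Z %| L * N - L' * M)%Z -> L ^+ 2 = L' ^+ 2.
  move=> eN /dvdzP[t tE].
  have h : (L * L' + 27 * M * N) ^+ 2 + 27 * t ^+ 2 * p%:Z ^+ 2 = 16 * p%:Z ^+ 2.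
    transitivity ((L ^+ 2 + 27 * M ^+ 2) * (L' ^+ 2 + 27 * N ^+ 2)).
      transitivity ((L * L' + 27 * M * N) ^+ 2 + 27 * (t * p%:Z) ^+ 2); first by ring.
      by rewrite -tE; ring.
    by rewrite -e -eN; ring.
  have t0 : t = 0.
    have [//|tn] := eqVneq t 0.
    have t2 : 0 < t ^+ 2 by rewrite exprn_even_gt0.
    have P0 : 0 < p%:Z ^+ 2 by rewrite exprn_gt0.
    have tP : 0 <= (t ^+ 2 - 1) * p%:Z ^+ 2.
      by apply: mulr_ge0; [rewrite subr_ge0 -gtz0_ge1 | exact: ltW].
    move: h tP P0 (sqr_ge0 (L * L' + 27 * M * N)).
    move: (t ^+ 2) (p%:Z ^+ 2) ((L * L' + 27 * M * N) ^+ 2) => x y z; lia.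
  have LN : L * N = L' * M by apply: subr0_eq; rewrite tE t0 mul0r.
  have h2 : 4 * p%:Z * (N ^+ 2 - M ^+ 2) = 0.
    rewrite mulrBr {1}e eN.
    transitivity ((L * N) ^+ 2 - (L' * M) ^+ 2); first by ring.
    by rewrite LN subrr.
  have h3 : N ^+ 2 - M ^+ 2 = 0.
    by move/eqP: h2; rewrite !mulf_eq0 (gt_eqF p0) => /eqP.
  apply: (linear_comb_eq (A1 := -1) (A2 := 1) (A3 := 27) e eN h3); ring.
have : (p%:Z %| (L * M' - L' * M) * (L * - M' - L' * M))%Z.
  apply/dvdzP; exists (- 4 * (M' ^+ 2 - M ^+ 2)).
  transitivity ((L' ^+ 2 + 27 * M' ^+ 2) * M ^+ 2 - (L ^+ 2 + 27 * M ^+ 2) * M' ^+ 2).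
    by ring.
  by rewrite -e -e'; ring.
rewrite dvdzE abszM Euclid_dvdM // => /orP[d|d].
  exact: key e' d.
by apply: key d; rewrite sqrrN.
Qed.

Lemma euler_criterion (p n : nat) (a : int) : prime p -> p = n.*2.+1 ->
  (legendre a p)%:~R = a%:~R ^+ n :> 'F_p.
Proof.
move=> p_pr pE; have chF := pchar_Fp p_pr.
have n0 : (0 < n)%N by have := prime_gt1 p_pr; lia.
have natFp (x : 'F_p) : (nat_of_ord x)%:R = x by rewrite natr_Zp.
rewrite /legendre (dvdz_pcharf chF); case: ifPn => [/eqP ->|a0].
  by rewrite expr0n eqn0Ngt n0.
have [g gP] := Fp_prim_root p_pr.
have [i ai] := gen_pow p_pr gP a0.
have eqmod (x : nat) : ((x%:Z ^+ 2 == a %[mod p])%Z) = (x%:R ^+ 2 == a%:~R :> 'F_p).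
  by rewrite eqz_mod_dvd (dvdz_pcharf chF) intrB subr_eq0 -[(x%:Z ^+ 2)]/(x%:Z * x%:Z) intrM.
have pn : p.-1 = (n * 2)%N by rewrite pE muln2.
case: ifPn => [/existsP[x]|/existsPn ns].
  rewrite eqmod => /eqP e; rewrite -e -exprM mulnC -pn Fp_fermat //.
  by apply: contraNneq a0 => x0; rewrite -e x0 expr0n.
have gn : g ^+ n = -1.
  have /eqP : (g ^+ n - 1) * (g ^+ n + 1) = 0.
    transitivity ((g ^+ n) ^+ 2 - 1); first by ring.
    by rewrite -exprM -pn (prim_expr_order gP) subrr.
  rewrite mulf_eq0 subr_eq0 addr_eq0 -(prim_order_dvd gP) pn => /orP[|/eqP //].
  by move=> /(dvdn_leq n0); lia.
(* An even power of the generator would be a square. *)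
have iodd : odd i.
  apply: contraT => ie; have := odd_double_half i; rewrite (negPf ie) add0n => ih.
  pose y := g ^+ i./2.
  have ylt : (nat_of_ord y < p)%N by rewrite -[X in (_ < X)%N](Fp_cast p_pr) ltn_ord.
  have := ns (Ordinal ylt); rewrite eqmod /= natFp ai.
  by rewrite -exprM muln2 ih eqxx.
rewrite ai exprAC gn -signr_odd iodd expr1 //.
Qed.

(** * Specialization at a point of Q(sqrt 10) *)

Section PIntegral.
Variable p : nat.

(** The algebraic numbers that are integral at all the places above p. *)
Definition pint (x : algC) := exists2 m : nat, coprime p m & m%:R * x \in Aint.

Lemma pint_Aint x : x \in Aint -> pint x.
Proof. by exists 1%N; rewrite ?coprimen1 // mul1r. Qed.

Lemma pint_int (z : int) : pint z%:~R.
Proof. by apply/pint_Aint/Aint_int. Qed.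

Lemma pint_nat (k : nat) : pint k%:R.
Proof. exact: (pint_int k). Qed.

Lemma pintM x y : pint x -> pint y -> pint (x * y).
Proof.
move=> [m cm xm] [k ck yk]; exists (m * k)%N; first by rewrite coprimeMr cm.
by rewrite natrM mulrACA rpredM.
Qed.

Lemma pintD x y : pint x -> pint y -> pint (x + y).
Proof.
move=> [m cm xm] [k ck yk]; exists (m * k)%N; first by rewrite coprimeMr cm.
have -> : (m * k)%:R * (x + y) = k%:R * (m%:R * x) + m%:R * (k%:R * y).
  by rewrite natrM; ring.
have AN i : i%:R \in Aint by exact: (Aint_int i).
by apply: rpredD; apply: rpredM.
Qed.

Lemma pintN x : pint x -> pint (- x).
Proof. by move=> px; rewrite -mulN1r; apply: pintM => //; apply: (pint_int (-1)). Qed.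

Lemma pintX x k : pint x -> pint (x ^+ k).
Proof.
move=> px; elim: k => [|k IH]; first by rewrite expr0; apply: (pint_nat 1).
by rewrite exprS; apply: pintM.
Qed.

Lemma pint_sum (I : finType) (P : pred I) (G : I -> algC) :
  (forall i, P i -> pint (G i)) -> pint (\sum_(i | P i) G i).
Proof. by move=> PG; apply: (big_ind pint) => //; [apply: (pint_nat 0) | apply: pintD]. Qed.

Lemma pintV m : (0 < m)%N -> coprime p m -> pint m%:R^-1.
Proof. by move=> m0 cm; exists m; rewrite // divff ?pnatr_eq0 -?lt0n. Qed.

Lemma pint_horner (Q : {poly int}) x : pint x -> pint (map_poly intr Q).[x].
Proof.
move=> px; rewrite horner_coef; apply: pint_sum => i _.
by rewrite coef_map /=; apply: pintM; [apply: pint_int | apply: pintX].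
Qed.

Lemma pint_ratr q : pint (ratr q) -> p_integral p q.
Proof.
move=> [m cm mq]; rewrite /p_integral; apply: coprime_dvdr cm.
have mqQ : m%:R * ratr q \in Crat.
  by apply/CratP; exists (m%:R * q); rewrite rmorphM rmorph_nat.
have /intrP[z zE] := Cint_rat_Aint mqQ mq.
have e : m%:R * q = z%:~R.
  by apply: (fmorph_inj (@ratr algC)); rewrite rmorphM rmorph_nat zE rmorph_int.
have e2 : m%:Z * numq q = z * denq q.
  apply/eqP; rewrite -(eqr_int rat) !intrM numqE; apply/eqP.
  by rewrite mulrA -[m%:~R]/(m%:R) e.
have : (denq q %| m%:Z * numq q)%Z by rewrite e2 dvdz_mull.
rewrite Gauss_dvdzl ?dvdzE //=.
by rewrite /coprimez /gcdz /= gcdnC; have := coprime_num_den q; rewrite /coprime => /eqP ->.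
Qed.

(** A congruence of rationals may be proved in the larger ring of [pint] numbers,
    since its rational elements are the p-integral rationals. *)
Lemma congr_ratI (m : nat) x y : (0 < m)%N -> pint (ratr x) -> pint (ratr y) ->
  (exists2 c, pint c & ratr x - ratr y = m%:R * c) -> congr_rat p m x y.
Proof.
move=> m0 px py [c pc e]; split; try exact: pint_ratr.
have mR : m%:R != 0 :> rat by rewrite pnatr_eq0 -lt0n.
exists ((x - y) / m%:R); last by rewrite mulrC divfK.
apply: pint_ratr; rewrite rmorphM fmorphV rmorph_nat rmorphB /= e mulrC mulKf //.
by rewrite pnatr_eq0 -lt0n.
Qed.
End PIntegral.

Section MainProof.
Variables (p n : nat).
Hypotheses (p_pr : prime p) (pE : p = n.*2.+1) (p_gt5 : (5 < p)%N).

Lemma pintV_smooth i j k : pint p (2 ^+ i * 3 ^+ j * 5 ^+ k)^-1.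
Proof.
have cop q : (0 < q)%N -> (q <= 5)%N -> coprime p q.
  move=> q0 q5; rewrite prime_coprime // gtnNdvd //; exact: leq_ltn_trans p_gt5.
rewrite -!natrX -!natrM; apply: pintV; first by rewrite !muln_gt0 !expn_gt0.
by rewrite !coprimeMr !coprimeXr ?cop.
Qed.

Lemma dvdn_bin_pred j : (p <= j)%N -> (j < p.-1 + p)%N -> (p %| 'C(j, p.-1))%N.
Proof.
move=> pj jp; have p1 := prime_gt1 p_pr.
have ndvd k : (k < p)%N -> ~~ (p %| k`!)%N.
  move=> kp; rewrite -[p in (p %| _)%N]expn1 pfactor_dvdn ?fact_gt0 // -ltnNge ltnS.
  by rewrite logn_fact_lt_sqr // ?divn_small //; nia.
have := dvdn_fact (_ : 0 < p <= j)%N; rewrite pj prime_gt0 // => /(_ isT).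
rewrite -(@bin_fact j p.-1); last by lia.
rewrite !Euclid_dvdM // => /orP[//|/orP[]] h; exfalso; move: h; apply/negP; apply: ndvd; lia.
Qed.

(** The polynomial has degree below 2p-2, and C(j,p-1) is divisible by p for
    p <= j < 2p-1. *)
Lemma coef_translate_modp (P : {poly int}) (c : algC) : c \in Aint ->
  (size P < p.-1 + p)%N ->
  exists2 d, pint p d &
    (map_poly intr P \Po ('X + c%:P))`_p.-1 = (P`_p.-1)%:~R + p%:R * d.
Proof.
move=> cA sP; rewrite coef_translate size_map_inj_poly ?rmorph0 //; last exact: intr_inj.
pose G j : algC := (map_poly intr P)`_j * (c ^+ (j - p.-1) *+ 'C(j, p.-1)).
suff [d pd e] : exists2 d, pint p d &
    \sum_(j < size P | (j : nat) != p.-1) G j = p%:R * d.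
  exists d => //; rewrite -e.
  have [pP|Pp] := ltnP p.-1 (size P).
    rewrite (bigD1 (Ordinal pP)) //= /G subnn expr0 binn mulr1n mulr1 coef_map /=.
    by congr (_ + _); apply: eq_bigl => j.
  rewrite nth_default // add0r; apply: eq_bigl => j.
  by apply/esym/eqP => jp; have := ltn_ord j; rewrite jp ltnNge Pp.
pose R j : algC := if (p <= j)%N then
   (map_poly intr P)`_j * (c ^+ (j - p.-1) *+ ('C(j, p.-1) %/ p)) else 0.
exists (\sum_(j < size P | (j : nat) != p.-1) R j).
  apply: pint_sum => j _; rewrite /R; case: ifP => _; last exact: (pint_nat p 0).
  rewrite coef_map /= -mulr_natr; apply: pintM; first exact: pint_int.
  by apply: pintM; [apply/pint_Aint/rpredX | apply: pint_nat].
rewrite mulr_sumr; apply: eq_bigr => j jp; rewrite /R /G.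
case: leqP => pj.
  have /divnK e : (p %| 'C(j, p.-1))%N.
    by apply: dvdn_bin_pred => //; apply: leq_ltn_trans sP; apply: ltnW.
  by rewrite -{1}e mulrCA -(mulr_natr _ (_ * _)) natrM -(mulr_natr _ (_ %/ _)); ring.
rewrite bin_small ?mulr0n ?mulr0 //; move: jp; lia.
Qed.

(** The Hasse invariant of the rational curve, lifted to an integer. *)
Definition hasse_coef : int := (curve_poly int ^+ n)`_n.*2.

Lemma map_curve (R S : comNzRingType) (f : {rmorphism R -> S}) :
  map_poly f (curve_poly R) = curve_poly S.
Proof.
by rewrite /curve_poly !(rmorph_nat, rmorphXn, rmorphN, rmorphM, rmorphD) /= map_polyX.
Qed.

Lemma hasse_coef_Fp : hasse_coef%:~R =
  \sum_(i < n.+1 | (3 * i == n.*2)%N) 'C(n, i)%:R * 1458 ^+ (n - i) :> 'F_p.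
Proof.
have n0 : (0 < n)%N by lia.
rewrite -(coef_curveP_exp (pchar_Fp p_pr) pE n0) /hasse_coef.
by rewrite -(map_curve (intmul 1 : {rmorphism int -> 'F_p})) -rmorphXn coef_map.
Qed.

Variable r : algC.
Hypothesis r2 : r ^+ 2 = 10.

Lemma Aint_r : r \in Aint.
Proof.
apply: (@root_monic_Aint ('X^2 - 10%:P)).
- by rewrite /root !hornerE r2 subrr.
- by rewrite monicXnsubC.
apply/polyOverP => i; rewrite coefB coefXn coefC; apply/intrP.
by exists ((i == 2)%N%:Z - (if i == 0%N then 10 else 0)); rewrite intrB; case: (i == 0%N).
Qed.

Let e := 6 * r.
Let s := 506 - 160 * r.
(** The point x0 of Q(sqrt 10) where x(1-432x) = -1/12288000. It is
    -s/(64 e^3), the parameter that [coef_cubic_exp] attaches to the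
    curve with coefficients e and s. *)
Definition cm_point : algC := (800 - 253 * r) / (2 ^+ 10 * 3 ^+ 3 * 5 ^+ 2).

(** The curve with coefficients e and s is x^3 - 120x + 506 expanded around
    its critical point 2r. *)
Lemma hasse_model : exists2 d, pint p d &
  (('X^3 + e *: 'X^2 + s%:P) ^+ n)`_n.*2 = hasse_coef%:~R + p%:R * d.
Proof.
have pn : p.-1 = n.*2 by rewrite pE.
have cA : 2 * r - 6 \in Aint.
  by rewrite rpredB ?rpredM ?Aint_r // ?(Aint_int 2) ?(Aint_int 6).
have [|d pd] := @coef_translate_modp (curve_poly int ^+ n) _ cA.
  apply: (@leq_ltn_trans (3 * n).+1); last by rewrite pE; lia.
  apply: leq_trans (size_poly_exp_leq _ _) _.
  by rewrite ltnS leq_mul2r -subn1 leq_subLR size_curve_poly orbT.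
move=> h; rewrite pn -/hasse_coef in h; exists d => //; rewrite -h; congr (nth 0 (polyseq _) _).
rewrite rmorphXn /= map_curve.
rewrite [RHS](rmorphXn (comp_poly ('X + (2 * r - 6)%:P))) /=; congr (_ ^+ _).
have r2P : (r%:P) ^+ 2 = 10 :> {poly algC} by rewrite -polyC_exp r2 polyC_natr.
rewrite /curve_poly /e /s -mul_polyC.
rewrite !(rmorph_nat, rmorphXn, rmorphN, rmorphM, rmorphD) /= comp_polyX.
apply: (linear_comb_eq1 (A := - (12 * 'X + 8 * r%:P)) r2P).
ring.
Qed.

Lemma cm_point_arg : cm_point * (1 - 432 * cm_point) = (- (3 * 160 ^+ 3))^-1.
Proof.
rewrite /cm_point.
apply: (linear_comb_eq1 (A := - 432 * 253 ^+ 2 / (2 ^+ 10 * 3 ^+ 3 * 5 ^+ 2) ^+ 2) r2).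
by field; rewrite ?pnatr_eq0.
Qed.

Lemma cm_point_pint : pint p cm_point.
Proof.
apply: pintM.
  apply: pintD; first exact: (pint_nat p 800).
  by apply/pintN/pintM; [exact: (pint_nat p 253) | apply/pint_Aint/Aint_r].
exact: pintV_smooth.
Qed.

Lemma horner_clausen_arg (x : algC) :
  (map_poly intr clausen_arg).[x] = x * (1 - 432 * x).
Proof.
rewrite /clausen_arg rmorphM rmorphB rmorphM rmorph1 rmorph_nat /= map_polyX.
by rewrite -polyC_natr !(hornerM, hornerD, hornerN, hornerX, hornerC).
Qed.

(** Stated with variables, so that the numerals of the theorem are never expanded
    when its denominator is moved from the rationals to the algebraic numbers. *)
Lemma ratr_denominator (a b : nat) :
  ratr (- (a%:R * b%:R ^+ 3)) = - (a%:R * b%:R ^+ 3) :> algC.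
Proof. by rewrite rmorphN rmorphM rmorphXn !rmorph_nat. Qed.

Lemma ratr_frac (N k : nat) (D : rat) (D' : algC) : ratr D = D' ->
  ratr (N%:R / D ^+ k) = N%:R * D'^-1 ^+ k.
Proof. by move=> <-; rewrite rmorphM fmorphV rmorphXn rmorph_nat exprVn. Qed.

Lemma ratr_binom_sum : ratr (binom_sum p) = (map_poly intr (trunc3F2 p)).[cm_point].
Proof.
rewrite /binom_sum big_mkord /trunc3F2 !rmorph_sum horner_sum; apply: eq_bigr => k _.
rewrite [X in X.[_]]rmorphM [X in (_ * X).[_]]rmorphXn.
rewrite [X in (X * _).[_]]rmorph_nat /= hornerM horner_exp horner_clausen_arg.
rewrite cm_point_arg -polyC_natr hornerC.
have -> : ('C(2 * k, k) * 'C(3 * k, k) * 'C(6 * k, 3 * k))%N = coef3F2 k.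
  by rewrite /coef3F2 /coef2F1; unlock; rewrite mulnA.
exact: (ratr_frac _ _ (ratr_denominator 3 160)).
Qed.

(** [coef2F1_pchar] lifted to the integers. *)
Lemma coef2F1_modp k : (k < p)%N -> exists q : int,
  (coef2F1 k)%:Z = (- 64) ^+ k * ('C(n, k) * 'C(n - k, 2 * k))%N%:Z + p%:Z * q.
Proof.
move=> kp; have chF := pchar_Fp p_pr.
have small : (p %| coef2F1 k)%N || (6 * k < p)%N.
  by case: (ltnP (6 * k) p) => [|pk]; rewrite ?orbT // dvdn_coef2F1.
have h := coef2F1_pchar chF pE kp small.
have : (p%:Z %| (coef2F1 k)%:Z - (- 64) ^+ k * ('C(n, k) * 'C(n - k, 2 * k))%N%:Z)%Z.
  rewrite (dvdz_pcharf chF) intrB intrM rmorphXn /= -[(coef2F1 k)%:~R]/((coef2F1 k)%:R) h.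
  by rewrite subrr.
by case/dvdzP => q /(canRL (subrK _)) ->; exists q; rewrite addrC [q * _]mulrC.
Qed.

Let f : algC := (map_poly intr (trunc2F1 p)).[cm_point].

Lemma inv_e_pint : pint p (r / 60).
Proof.
apply: pintM; [exact/pint_Aint/Aint_r | have -> : 60 = 2 ^+ 2 * 3 ^+ 1 * 5 ^+ 1 :> algC by ring].
exact: pintV_smooth.
Qed.

(** Dividing [coef_cubic_exp] by e^n leaves a sum of powers of s / e^3 = -64 x0, whose
    coefficients are those of the 2F1 by [coef2F1_modp]. *)
Lemma clausen_value : exists2 d, pint p d & f = (r / 60) ^+ n * hasse_coef%:~R + p%:R * d.
Proof.
have inve := inv_e_pint.
have [d pd hd] := hasse_model.
pose q k : algC := ('C(n, k) * 'C(n - k, 2 * k))%N%:R.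
have ptE : (r / 60) ^+ 3 * s = - 64 * cm_point.
  rewrite /s /cm_point.
  apply: (linear_comb_eq1 (A := (506 * r - 160 * (r ^+ 2 + 10)) / 60 ^+ 3) r2).
  by field; rewrite ?pnatr_eq0.
have invE : r / 60 * e = 1.
  rewrite /e.
  apply: (linear_comb_eq1 (A := 6 / 60) r2).
  by field; rewrite ?pnatr_eq0.
have model : (r / 60) ^+ n * (('X^3 + e *: 'X^2 + s%:P) ^+ n)`_n.*2 =
    \sum_(k < p) q k * (- 64 * cm_point) ^+ k.
  rewrite coef_cubic_exp mulr_sumr.
  transitivity (\sum_(k < n.+1) q k * (- 64 * cm_point) ^+ k).
    apply: eq_bigr => k _; rewrite -/(q k) -ptE.
    have [kn|nk] := leqP (3 * k) n; last first.
      suff -> : q k = 0 by rewrite !mul0r mulr0.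
      by rewrite /q (@bin_small (n - k)) ?muln0 //; lia.
    move: (r / 60) invE => a invE.
    rewrite [X in _ = _ * X]exprMn -exprM -{1}(subnKC kn) exprD.
    transitivity (q k * (a * e) ^+ (n - 3 * k) * (a ^+ (3 * k) * s ^+ k)).
      by rewrite [(a * e) ^+ _]exprMn; ring.
    by rewrite invE expr1n mulr1.
  rewrite (big_ord_widen p (fun k => q k * (- 64 * cm_point) ^+ k)); last by lia.
  rewrite [RHS](bigID (fun k : 'I_p => (k < n.+1)%N)) /= [X in _ = _ + X]big1 ?addr0 //.
  by move=> k; rewrite -leqNgt => nk; rewrite /q bin_small ?mul0n ?mul0r.
have [R pR eR] : exists2 R, pint p R &
    f - \sum_(k < p) q k * (- 64 * cm_point) ^+ k = p%:R * R.
  have fE : f = \sum_(k < p) (coef2F1 k)%:R * cm_point ^+ k.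
    rewrite /f /trunc2F1 rmorph_sum horner_sum; apply: eq_bigr => k _.
    by rewrite rmorphM rmorph_nat /= map_polyXn -polyC_natr hornerM hornerC hornerXn.
  rewrite fE -sumrB.
  apply: (big_ind (fun x => exists2 R, pint p R & x = p%:R * R)).
  - by exists 0; [exact: (pint_nat p 0) | rewrite mulr0].
  - move=> _ _ [x px ->] [y py ->].
    by exists (x + y); [exact: pintD | rewrite mulrDr].
  move=> k _; have [c hc] := coef2F1_modp (ltn_ord k).
  exists (c%:~R * cm_point ^+ k).
    by apply: pintM; [exact: pint_int | apply/pintX/cm_point_pint].
  have -> : (coef2F1 k)%:R = (- 64) ^+ k * q k + p%:R * c%:~R :> algC.
    by rewrite -[(coef2F1 k)%:R]/((coef2F1 k)%:Z%:~R) hc intrD !intrM rmorphXn.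
  by rewrite [(- 64 * _) ^+ _]exprMn; ring.
exists (R + (r / 60) ^+ n * d).
  by apply: pintD => //; apply: pintM => //; apply: pintX.
transitivity (\sum_(k < p) q k * (- 64 * cm_point) ^+ k + p%:R * R).
  by rewrite -eR addrC subrK.
by rewrite -model hd; ring.
Qed.

Lemma binom_sum_value : exists2 d, pint p d &
  ratr (binom_sum p) = f ^+ 2 + (p ^ 2)%N%:R * d.
Proof.
have [Q eQ] := clausen_congr p_pr p_gt5.
exists (map_poly intr Q).[cm_point]; first exact: pint_horner cm_point_pint.
rewrite ratr_binom_sum -[trunc3F2 p](subrK (trunc2F1 p ^+ 2)) eQ addrC rmorphD hornerD.
congr (_ + _); first by rewrite rmorphXn horner_exp.
by rewrite rmorphM rmorph_nat hornerM -polyC_natr hornerC.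
Qed.

Lemma pint_f : pint p f.
Proof. exact: pint_horner cm_point_pint. Qed.

Lemma binom_sum_congr_2mod3 : (p = 2 %[mod 3])%N -> congr_rat p (p ^ 2)%N (binom_sum p) 0.
Proof.
move=> p2; have [D pD SE] := binom_sum_value; have [d pd fE] := clausen_value.
have /dvdzP[h hE] : (p%:Z %| hasse_coef)%Z.
  rewrite (dvdz_pcharf (pchar_Fp p_pr)) hasse_coef_Fp big1 // => i /eqP iE.
  by move: p2; rewrite [in X in X -> _]pE; lia.
pose x := (r / 60) ^+ n * h%:~R + d.
have px : pint p x.
  by apply: pintD => //; apply: pintM; [exact/pintX/inv_e_pint | exact: pint_int].
have fx : f = p%:R * x by rewrite fE hE intrM /x; ring.
apply: congr_ratI.
- by rewrite expn_gt0 prime_gt0.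
- by rewrite SE; apply: pintD; [exact/pintX/pint_f | apply: pintM => //; exact: pint_nat].
- by rewrite rmorph0; exact: (pint_nat p 0).
exists (x ^+ 2 + D); first by apply: pintD => //; exact: pintX.
by rewrite rmorph0 SE fx natrX; ring.
Qed.

(** The Hasse invariant is C(3l,2l) 1458^l with m = 2l and p = 6l+1. By
    [bin_half], C(2m,m) is 16^l C(3l,2l). The squares of 1458 = 2 3^6 and of 16
    have the same l-th powers, because 2^(6l) = 3^(6l) = 1. *)
Lemma hasse_coef_sqr (m : nat) : p = (3 * m).+1 ->
  hasse_coef%:~R ^+ 2 = 'C(2 * m, m)%:R ^+ 2 :> 'F_p.
Proof.
move=> p3; have nm : (n.*2 = 3 * m)%N by lia.
have mn : (m < n.+1)%N by lia.
have unit (k : nat) : (0 < k <= 5)%N -> (k%:R : 'F_p) ^+ (3 * m) = 1.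
  move=> /andP[k0 k5]; rewrite -nm -[n.*2]/(n.*2.+1.-1) -pE Fp_fermat //.
  rewrite -(dvdn_pcharf (pchar_Fp p_pr)) gtnNdvd //; exact: leq_ltn_trans p_gt5.
rewrite hasse_coef_Fp (bigD1 (Ordinal mn)) /=; last by rewrite nm.
rewrite big1 ?addr0; last first.
  by move=> i /andP[/eqP e1 /eqP ne]; case: ne; apply: val_inj => /=; lia.
rewrite (bin_half (pchar_Fp p_pr) pE); last by lia.
have e1 : (1458 : 'F_p) = 2 * 3 ^+ 6 by ring.
have e2 : (- 4 : 'F_p) ^+ 2 = 2 * 2 ^+ 3 by ring.
rewrite e1 [LHS]exprMn [RHS]exprMn mulrC; congr (_ * _).
rewrite -[LHS]exprM -[RHS]exprM [(m * 2)%N]mulnC [RHS]exprM e2.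
have -> : ((n - m) * 2 = m)%N by lia.
rewrite [LHS]exprMn [RHS]exprMn; congr (_ * _); rewrite -[LHS]exprM -[RHS]exprM.
rewrite (unit 2) // (_ : 6 * m = 3 * m * 2)%N; last by lia.
by rewrite exprM (unit 3) // expr1n.
Qed.

(** The square of e^n is 360^n = 6^(2n) 10^n, that is 10^n modulo p, which is the
    Legendre symbol of 10. *)
Lemma binom_sum_congr_1mod3 (L : int) :
  hasse_coef%:~R ^+ 2 = L%:~R ^+ 2 :> 'F_p ->
  congr_rat p p (binom_sum p) ((legendre 10 p)%:~R * L%:~R ^+ 2).
Proof.
move=> hL; have [D pD SE] := binom_sum_value; have [d pd fE] := clausen_value.
have unit (k : nat) : (0 < k <= 5)%N -> (k%:R : 'F_p) ^+ n.*2 = 1.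
  move=> /andP[k0 k5]; rewrite -[n.*2]/(n.*2.+1.-1) -pE Fp_fermat //.
  rewrite -(dvdn_pcharf (pchar_Fp p_pr)) gtnNdvd //; exact: leq_ltn_trans p_gt5.
have u60 : (60 : 'F_p) ^+ n.*2 = 1.
  have -> : 60 = 2 * 2 * (3 * 5) :> 'F_p by ring.
  by rewrite [LHS]exprMn [X in X * _]exprMn [X in _ * X]exprMn !unit // !mulr1.
have /dvdzP[t tE] : (p%:Z %| hasse_coef ^+ 2 - 360 ^+ n * (legendre 10 p * L ^+ 2))%Z.
  have leg := euler_criterion 10 p_pr pE.
  rewrite (dvdz_pcharf (pchar_Fp p_pr)) intrB intrM intrM !rmorphXn /= hL leg.
  have e60 : 360%:~R * 10%:~R = 60 ^+ 2 :> 'F_p.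
    by rewrite -[360%:~R]/(360%:R) -[10%:~R]/(10%:R); ring.
  by rewrite mulrA -[X in X * _]exprMn e60 -exprM mul2n u60 mul1r subrr.
have i360 : pint p (360 ^+ n)^-1.
  rewrite -exprVn; apply: pintX.
  have -> : 360 = 2 ^+ 3 * 3 ^+ 2 * 5 ^+ 1 :> algC by ring.
  exact: pintV_smooth.
have r360 : (r / 60) ^+ n * (r / 60) ^+ n = (360 ^+ n)^-1.
  rewrite -exprMn -exprVn; congr (_ ^+ _).
  apply: (linear_comb_eq1 (A := 60 ^- 2) r2).
  by field; rewrite ?pnatr_eq0.
have tE' : hasse_coef%:~R ^+ 2 =
    t%:~R * p%:R + 360 ^+ n * ((legendre 10 p)%:~R * L%:~R ^+ 2) :> algC.
  have := congr1 (intmul (1 : algC)) tE.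
  rewrite intrB !intrM rmorphXn /= -[360%:~R]/(360%:R : algC).
  rewrite -[p%:Z%:~R]/(p%:R : algC) => h.
  by apply: (linear_comb_eq1 (A := 1) h); ring.
have rE : ratr ((legendre 10 p)%:~R * L%:~R ^+ 2) =
    (legendre 10 p)%:~R * L%:~R ^+ 2 :> algC.
  by rewrite rmorphM rmorphXn !rmorph_int.
have pL : pint p ((legendre 10 p)%:~R * L%:~R ^+ 2).
  by apply: pintM; [exact: pint_int | apply/pintX/pint_int].
apply: congr_ratI.
- exact: prime_gt0.
- by rewrite SE; apply: pintD; [exact/pintX/pint_f | apply: pintM => //; exact: pint_nat].
- by rewrite rE.
exists ((360 ^+ n)^-1 * t%:~R + 2 * (r / 60) ^+ n * hasse_coef%:~R * d + p%:R * d ^+ 2 + p%:R * D).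
  have pr := pintX n inv_e_pint.
  have ph := pint_int p hasse_coef.
  have pp := pint_nat p p.
  have p2 := pint_nat p 2.
  have pt := pint_int p t.
  by do ![assumption | apply: pintD | apply: pintM | apply: pintX].
rewrite rE SE fE natrX.
transitivity ((360 ^+ n)^-1 * hasse_coef%:~R ^+ 2 - (legendre 10 p)%:~R * L%:~R ^+ 2
  + p%:R * (2 * (r / 60) ^+ n * hasse_coef%:~R * d + p%:R * d ^+ 2 + p%:R * D)).
  by rewrite -r360; ring.
rewrite tE' mulrDr mulKf; last by rewrite expf_neq0 // pnatr_eq0.
ring.
Qed.
End MainProof.

Theorem theorem4p13 (p : nat) (p_prime : prime p) (p_gt5 : (5 < p)%N) :
  ((p = 2 %[mod 3])%N -> congr_rat p (p ^ 2)%N (binom_sum p) 0) /\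
  ((p = 1 %[mod 3])%N ->
     (exists L M : int, 4 * p%:Z = L ^+ 2 + 27 * M ^+ 2) /\
     (forall L M : int, 4 * p%:Z = L ^+ 2 + 27 * M ^+ 2 ->
        congr_rat p p (binom_sum p) ((legendre 10 p)%:~R * L%:~R ^+ 2))).
Proof.
have pE : p = p./2.*2.+1.
  case: (even_prime p_prime) => [p2|p_odd]; first by move: p_gt5; rewrite p2.
  by rewrite -[LHS]odd_double_half p_odd.
have r2 : sqrtC 10 ^+ 2 = 10 :> algC by exact: sqrtCK.
split=> [p2|p1].
  by have := binom_sum_congr_2mod3 p_prime pE p_gt5 r2 p2.
have p3 : p = (3 * (p %/ 3)).+1 by move: p1; lia.
have [g gP] := Fp_prim_root p_prime.
have [L0 [M0 [L0p L0E]]] := cubic_four_p p_prime p3 gP.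
split=> [|L M LM]; first by exists L0, M0.
apply: (binom_sum_congr_1mod3 p_prime pE p_gt5 r2).
rewrite (hasse_coef_sqr p_prime pE p_gt5 p3) -L0E.
have LE := four_p_unique p_prime L0p LM.
by have := congr1 (intmul (1 : 'F_p)) LE; rewrite !rmorphXn.
Qed.
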